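(* Let $\mathbf n=(n_1,\ldots,n_k)\in\mathbb N^k$ with $n_i\ge2$ for all $i$. If $\mathbf T$ is a graded pure element of rank one in the noncommutative polyball $\mathbf B_{\mathbf n}(\mathcal H)$, then $$\mathrm{curv}(\mathbf T)=\chi(\mathbf T).$$
   Context: All Hilbert spaces are complex. $B(\mathcal H)^{n_1}\times_c\cdots\times_cB(\mathcal H)^{n_k}$ is the set of tuples $\mathbf X=(X_1,\ldots,X_k)$, $X_i=(X_{i,1},\ldots,X_{i,n_i})\in B(\mathcal H)^{n_i}$, such that every entry of $X_s$ commutes with every entry of $X_t$ for $s\ne t$ (entries of one $X_i$ need not commute). $\Phi_{X_i}(Y):=\sum_{j=1}^{n_i}X_{i,j}YX_{i,j}^*$, and for $\mathbf p\in\{0,1\}^k$, $\mathbf\Delta_{\mathbf X}^{\mathbf p}:=(id-\Phi_{X_1})^{p_1}\circ\cdots\circ(id-\Phi_{X_k})^{p_k}$. The polyball $\mathbf B_{\mathbf n}(\mathcal H)$ is the set of such $\mathbf X$ with $\mathbf\Delta_{\mathbf X}^{\mathbf p}(I)\ge0$ for all $\mathbf p\in\{0,1\}^k$. The defect operator is $\mathbf\Delta_{\mathbf X}(I):=(id-\Phi_{X_1})\circ\cdots\circ(id-\Phi_{X_k})(I)$; the rank of $\mathbf X$ is the rank of $\mathbf\Delta_{\mathbf X}(I)$. $\mathbf X$ is pure if $\Phi_{X_i}^p(I)\to0$ strongly as $p\to\infty$ for each $i$. $\mathbf X$ is graded if there is a strongly continuous unitary representation $U:\mathbb T^k\to B(\mathcal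 H)$ of the $k$-torus (a gauge group) with $U(\lambda)X_{i,j}U(\lambda)^*=\lambda_iX_{i,j}$ for all $\lambda=(\lambda_1,\ldots,\lambda_k)\in\mathbb T^k$ and all $i,j$. $\mathbb F_{n_i}^+$ is the unital free semigroup on generators $g_1^i,\ldots,g_{n_i}^i$ with identity $g_0^i$, $|\alpha|$ denotes word length, $T_{i,\alpha}:=T_{i,j_1}\cdots T_{i,j_p}$ for $\alpha=g^i_{j_1}\cdots g^i_{j_p}$, $T_{i,g_0^i}:=I$. For $\mathbf q\in\mathbb Z_+^k$, $M_{\mathbf q}(\mathbf T):=\mathrm{span}\{T_{1,\alpha_1}\cdots T_{k,\alpha_k}h:|\alpha_i|\le q_i,\ h\in\mathbf\Delta_{\mathbf T}(I)(\mathcal H)\}$. For $\mathbf T$ of finite rank, the Euler characteristic is $$\chi(\mathbf T):=\lim_{m\to\infty}\frac{\dim M_{\mathbf q^{(m)}}(\mathbf T)}{\prod_{i=1}^k(1+n_i+\cdots+n_i^{q_i^{(m)}})}$$ for any increasing cofinal sequence $\mathbf q^{(m)}$ in $\mathbb Z_+^k$ (the limit exists and is independent of the sequence). $H_{n_i}$ is an $n_i$-dimensional complex Hilbert space with orthonormal basis $e^i_1,\ldots,e^i_{n_i}$; $F^2(H_{n_i})=\mathbb C1\oplus\bigoplus_{p\ge1}H_{n_i}^{\otimes p}$ has orthonormal basis $e^i_\alpha:=e^i_{j_1}\otimes\cdots\otimes e^i_{j_p}$ for $\alpha=g^i_{j_1}\cdots g^i_{j_p}$, $e^i_{g^i_0}:=1$.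 $P_q^{(i)}$ is the orthogonal projection of $F^2(H_{n_i})$ onto the span of $e^i_\alpha$, $|\alpha|=q$. The Berezin kernel $\mathbf K_{\mathbf T}:\mathcal H\to F^2(H_{n_1})\otimes\cdots\otimes F^2(H_{n_k})\otimes\overline{\mathbf\Delta_{\mathbf T}(I)(\mathcal H)}$ is $\mathbf K_{\mathbf T}h:=\sum_{\beta_i\in\mathbb F_{n_i}^+}e^1_{\beta_1}\otimes\cdots\otimes e^k_{\beta_k}\otimes\mathbf\Delta_{\mathbf T}(I)^{1/2}T_{1,\beta_1}^*\cdots T_{k,\beta_k}^*h$. The curvature is $$\mathrm{curv}(\mathbf T):=\lim_{m\to\infty}\frac1{\binom{m+k}{k}}\sum_{\substack{q_1,\ldots,q_k\ge0\\ q_1+\cdots+q_k\le m}}\frac{\mathrm{trace}\left[\mathbf K_{\mathbf T}^*(P^{(1)}_{q_1}\otimes\cdots\otimes P^{(k)}_{q_k}\otimes I)\mathbf K_{\mathbf T}\right]}{\mathrm{trace}\left[P^{(1)}_{q_1}\otimes\cdots\otimes P^{(k)}_{q_k}\right]}$$ (the limit is known to exist for trace class defect). *)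

(* Defs.v *)
From HB Require Import structures.
From mathcomp Require Import all_boot all_order all_algebra.
From mathcomp Require Import sesquilinear finmap complex.
From mathcomp Require Import all_classical all_reals all_analysis.
From mathcomp Require summability.

Set Implicit Arguments.
Unset Strict Implicit.
Unset Printing Implicit Defensive.

Import Order.TTheory GRing.Theory Num.Theory.
Import numFieldNormedType.Exports.

Local Open Scope classical_set_scope.
Local Open Scope complex_scope.
Local Open Scope ring_scope.

HB.mixin Record CompleteNormedModule_isHilbert (R : realType) (H : Type)
    & CompleteNormedModule R[i] H := {
  inner : {dot H for (@Num.conj R[i])} ;
  inner_norm : forall x : H, inner x x = `|x| ^+ 2
}.

(* Complex Hilbert spaces; [inner] is linear in its first argument. *)
#[short(type="hilbertType")]
HB.structure Definition Hilbert (R : realType) :=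
  {H of CompleteNormedModule R[i] H & CompleteNormedModule_isHilbert R H}.

(* A_0 \o A_1 \o ... \o A_(k-1) *)
Definition compose_all (V : Type) (k : nat) (A : 'I_k -> V -> V) : V -> V :=
  \big[(fun f g : V -> V => f \o g) / idfun]_(i < k) A i.

Section LinearAlgebra.
Context {R : realType} {V : lmodType R[i]}.

Definition lin_span (S : set V) : set V :=
  [set x | exists m (c : 'I_m -> R[i]) (v : 'I_m -> V),
     (forall i, S (v i)) /\ x = \sum_(i < m) c i *: v i].

Definition lin_independent (d : nat) (b : 'I_d -> V) : Prop :=
  forall c : 'I_d -> R[i], \sum_(i < d) c i *: b i = 0 -> forall i, c i = 0.

Definition has_dim (M : set V) (d : nat) : Prop :=
  exists b : 'I_d -> V, lin_independent b /\ lin_span (range b) = M.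

(* Only meaningful when M is a finite-dimensional subspace. *)
Definition dim (M : set V) : nat := xget 0%N (has_dim M).

End LinearAlgebra.

(* In this section a Hilbert space is presented as a subspace D of an lmodType V
   together with an inner product dot on D. A hilbertType H is presented by
   D = setT and dot = inner; l2(I; V) is presented by the subspace [ell2] of the
   functions I -> V and by the inner product [ell2_dot]. *)
Section InnerProduct.
Context {R : realType} {V W : lmodType R[i]}.
Variables (dot : V -> V -> R[i]) (D : set V).

Definition orthonormal_basis (E : set V) : Prop :=
  [/\ E `<=` D,
      forall x y, E x -> E y -> dot x y = (x == y)%:R &
      forall x, D x -> forall e : R[i], 0 < e ->
        exists2 y, lin_span E y & dot (x - y) (x - y) < e].

(* The trace of a trace-class operator A on D: the unordered sum of <A e, e>
   over some orthonormal basis, the value being independent of the basis. *)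
Definition trace (A : V -> V) : R[i] :=
  let E := xget set0 orthonormal_basis in
  summability.sum (fun e : set_type E => dot (A (val e)) (val e) : R[i]^o).

(* The adjoint of an operator A from D to a Hilbert space with inner product
   dotW (total and unique when A is bounded, by Riesz representation). *)
Definition adjoint (dotW : W -> W -> R[i]) (A : V -> W) : W -> V :=
  fun w => xget 0 [set v | D v /\ forall u, D u -> dotW (A u) w = dot u v].

Definition ell2 (I : choiceType) : set (I -> V) :=
  [set f | (forall i, D (f i)) /\ exists M : R[i], forall J : {fset I},
     \sum_(i <- J) dot (f i) (f i) <= M].

Definition ell2_dot (I : choiceType) (f g : I -> V) : R[i] :=
  summability.sum (fun i => dot (f i) (g i) : R[i]^o).

End InnerProduct.

Section Operators.
Context {R : realType} {H : hilbertType R}.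

Definition bounded_op (A : H -> H) : Prop := linear A /\ continuous A.

Definition adj (A : H -> H) : H -> H := adjoint inner setT inner A.

Definition positive_op (A : H -> H) : Prop := forall h, 0 <= inner (A h) h.

(* The positive square root of a positive bounded operator. *)
Definition sqrt_op (A : H -> H) : H -> H :=
  xget (fun=> 0)
    [set S | [/\ bounded_op S, positive_op S & forall h, S (S h) = A h]].

Definition unitary_op (A : H -> H) : Prop :=
  (forall x y, inner (A x) (A y) = inner x y) /\ range A = setT.

End Operators.

Section Polyball.
Context {R : realType} {H : hilbertType R} {k : nat} {n : 'I_k -> nat}.

Definition op_tuple : Type := forall i : 'I_k, 'I_(n i) -> {linear H -> H}.

Variable X : op_tuple.

Definition Phi (i : 'I_k) (Y : H -> H) : H -> H :=
  fun h => \sum_(j < n i) X j (Y (adj (X j) h)).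

Definition Delta (p : 'I_k -> bool) (Y : H -> H) : H -> H :=
  compose_all (fun i => iter (p i) (fun Z : H -> H => Z - Phi i Z)) Y.

Definition defect : H -> H := Delta (fun=> true) idfun.

Definition has_rank (r : nat) : Prop := has_dim (range defect) r.

Definition polyball : Prop :=
  [/\ forall i (j : 'I_(n i)), continuous (X j),
      forall s t (i : 'I_(n s)) (j : 'I_(n t)) h, s != t ->
        X i (X j h) = X j (X i h) &
      forall p, positive_op (Delta p idfun)].

Definition pure : Prop :=
  forall i h, iter p (Phi i) idfun h @[p --> \oo] --> (0 : H).

Definition torus : set 'rV[R[i]^o]_k := [set l | forall i, `|l 0 i| = 1].

(* U is only constrained on the torus. *)
Definition graded : Prop :=
  exists U : 'rV[R[i]^o]_k -> {linear H -> H},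
  [/\ forall l, torus l -> unitary_op (U l),
      forall h, U (const_mx 1) h = h,
      forall l m, torus l -> torus m -> forall h,
        U (\row_i (l 0 i * m 0 i)) h = U l (U m h),
      forall h, {within torus, continuous (fun l => U l h)} &
      forall l, torus l -> forall i (j : 'I_(n i)) h,
        U l (X j (adj (U l) h)) = (l 0 i : R[i]) *: X j h].

(* X_{i, j_1} ... X_{i, j_p} for the word alpha = j_1 ... j_p *)
Definition word_op (i : 'I_k) (alpha : seq 'I_(n i)) : H -> H :=
  foldr (fun j A => X j \o A) idfun alpha.

Definition words : choiceType := {dffun forall i : 'I_k, seq 'I_(n i)}.

Definition Mspace (q : 'I_k -> nat) : set H :=
  lin_span [set x | exists (alpha : words) (h : H),
    [/\ forall i, (size (alpha i) <= q i)%N, range defect h &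
        x = compose_all (fun i => word_op (alpha i)) h]].

Definition increasing_cofinal (q : nat -> 'I_k -> nat) : Prop :=
  (forall m i, (q m i <= q m.+1 i)%N) /\
  (forall r : 'I_k -> nat, exists m, forall i, (r i <= q m i)%N).

Definition euler_ratio (q : 'I_k -> nat) : R[i]^o :=
  (dim (Mspace q))%:R / \prod_(i < k) \sum_(0 <= p < (q i).+1) (n i)%:R ^+ p.

Definition is_euler_char (c : R[i]) : Prop :=
  forall q, increasing_cofinal q ->
    euler_ratio (q m) @[m --> \oo] --> (c : R[i]^o).

Definition euler_char : R[i] := xget 0 is_euler_char.

(* F^2(H_{n_1}) (x) ... (x) F^2(H_{n_k}) (x) K is identified with l2(words; K)
   by means of its expansions along e_{beta_1} (x) ... (x) e_{beta_k} (x) _. *)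
Definition berezin (h : H) : words -> H :=
  fun beta =>
    sqrt_op defect (compose_all (fun i => adj (word_op (beta i))) h).

(* P_{q_1} (x) ... (x) P_{q_k} (x) I *)
Definition fock_proj (V : lmodType R[i]) (q : 'I_k -> nat) (f : words -> V) :
    words -> V :=
  fun beta => if [forall i, size (beta i) == q i] then f beta else 0.

Definition fock_trace (q : 'I_k -> nat) : R[i] :=
  let dotC (a b : R[i]^o) : R[i] := a * b^* in
  trace (@ell2_dot _ _ dotC words) (@ell2 _ _ dotC setT words)
    (@fock_proj R[i]^o q).

(* The adjoint of [berezin] is applied to elements of
   l2(words; closure (range defect)) only. *)
Definition berezin_trace (q : 'I_k -> nat) : R[i] :=
  trace inner [set: H]
    (adjoint inner setT (@ell2_dot _ H inner words) berezin
       \o @fock_proj H q \o berezin).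

Definition curv_mean (m : nat) : R[i]^o :=
  ('C(m + k, k)%:R)^-1 *
  \sum_(q : {ffun 'I_k -> 'I_m.+1} | (\sum_i q i <= m)%N)
    berezin_trace (fun i => q i) / fock_trace (fun i => q i).

Definition curv : R[i] := lim (curv_mean @ \oo).

End Polyball.

Arguments op_tuple {R} H {k} n.

(* Main.v *)
From HB Require Import structures.
Require Import Defs.
From mathcomp Require Import all_boot all_order all_algebra complex.
From mathcomp Require Import finmap sesquilinear.
From mathcomp Require Import all_classical all_reals all_analysis.
From mathcomp Require summability.
From mathcomp Require Import ring.
Import Order.TTheory GRing.Theory Num.Theory.
Import numFieldNormedType.Exports.

(** Let w span the range of the defect operator, normalized so that the defect
    is h |-> <h, w> w, and let T_b be the product of operators spelled by a
    k-tuple of words b, whose degree is the vector of the lengths of its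
    components.

    The gauge group acts on T_b w through a character of the torus that depends
    only on the degree of b, so T_b w and T_c w are orthogonal as soon as b and
    c have different degrees [graded_orthogonal].  Telescoping the defect one
    factor at a time shows that the sum of |<h, T_b w>|^2 over the words b of a
    box of degrees is at most |h|^2, and differs from it by at most an error
    that tends to 0 for a pure tuple [frame_upper, frame_lower].  Orthogonality
    freezes this sum on the span of a box, so there the vectors of that box
    satisfy Parseval's identity exactly [box_parseval].  Consequently the
    dimension of M_q is the sum of the |T_b w|^2 over the words of degree at
    most q [dim_Mspace].  On the other side, the trace that enters the curvature
    at q is by Parseval the same sum over the words of degree exactly q
    [berezin_traceE], and the trace of the Fock space projection counts these
    words [fock_trace_card].

    Let density q be the average of |T_b w|^2 over the words of degree q.  The
    curvature means are averages of the density over the simplices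
    q_1 + ... + q_k <= m, and the Euler ratios are averages of the density of
    the degree over all words in a box.  The letters are contractions, so the
    density decreases when a coordinate of q grows [density_step].  In both
    families of averages the indices with a small coordinate become negligible
    [count_simplex, count_box], hence both converge to the infimum of the
    density [average_cvg]. *)

Set Implicit Arguments.
Unset Strict Implicit.
Unset Printing Implicit Defensive.

Local Open Scope classical_set_scope.
Local Open Scope ring_scope.

#[local] Existing Instance summability.totally_filter.

(** * Bessel and Parseval for an inner product on a subspace *)

Lemma cvg_sum_seq {K : numFieldType} {V : normedModType K} {T : Type}
    {I : eqType} (F : set_system T) (FF : Filter F) (s : seq I)
    (f : I -> T -> V) (l : I -> V) :
  (forall i, i \in s -> f i x @[x --> F] --> l i) ->
  \sum_(i <- s) f i x @[x --> F] --> \sum_(i <- s) l i.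
Proof.
elim: s => [|i s ih] fl.
  by under eq_fun do rewrite big_nil; rewrite big_nil; exact: cvg_cst.
under eq_fun do rewrite big_cons; rewrite big_cons.
apply: cvgD; first by apply: fl; rewrite mem_head.
by apply: ih => j js; apply: fl; rewrite inE js orbT.
Qed.

Section InnerOn.
Context {R : realType} {V : lmodType R[i]}.
Variables (dot : V -> V -> R[i]) (D : set V).

(** The pairing of square-summable families is sesquilinear only on that
    subspace, so the inner product axioms are relativized to a subspace D; the
    Hilbert space itself is the case where D is everything. *)
Record inner_on : Prop := InnerOn {
  inner_on0 : D 0;
  inner_onP : forall a x y, D x -> D y -> D (a *: x + y);
  dot_linear : forall a x y z, D x -> D y -> D z ->
    dot (a *: x + y) z = a * dot x z + dot y z;
  dotC : forall x y, D x -> D y -> dot x y = (dot y x)^*;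
  dot_ge0 : forall x, D x -> 0 <= dot x x }.

Hypothesis hD : inner_on.

Let D0 := inner_on0 hD.

Lemma inner_onZ a x : D x -> D (a *: x).
Proof. by move=> Dx; rewrite -[_ *: _]addr0; exact: inner_onP. Qed.

Lemma inner_onD x y : D x -> D y -> D (x + y).
Proof. by move=> Dx Dy; rewrite -[x]scale1r; exact: inner_onP. Qed.

Lemma inner_onB x y : D x -> D y -> D (x - y).
Proof. by move=> Dx Dy; rewrite addrC -scaleN1r; exact: inner_onP. Qed.

Lemma inner_on_sum (I : Type) (s : seq I) (f : I -> V) :
  (forall i, D (f i)) -> D (\sum_(i <- s) f i).
Proof.
by move=> Df; elim/big_ind : _ => // x y; exact: inner_onD.
Qed.

Lemma dot0l z : D z -> dot 0 z = 0.
Proof.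
move=> Dz; have := dot_linear hD 1 D0 D0 Dz.
rewrite scale1r addr0 mul1r => /eqP.
by rewrite -subr_eq subrr => /eqP.
Qed.

Lemma dotDl x y z : D x -> D y -> D z -> dot (x + y) z = dot x z + dot y z.
Proof. by move=> *; rewrite -[x]scale1r dot_linear// mul1r scale1r. Qed.

Lemma dotZl a x z : D x -> D z -> dot (a *: x) z = a * dot x z.
Proof. by move=> *; rewrite -[_ *: _]addr0 dot_linear// dot0l// addr0. Qed.

Lemma dotBl x y z : D x -> D y -> D z -> dot (x - y) z = dot x z - dot y z.
Proof.
move=> Dx Dy Dz; rewrite -scaleN1r dotDl//; last exact: inner_onZ.
by rewrite dotZl// mulN1r.
Qed.

Lemma dotBr x y z : D x -> D y -> D z -> dot x (y - z) = dot x y - dot x z.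
Proof.
move=> Dx Dy Dz; rewrite dotC//; last exact: inner_onB.
by rewrite dotBl// rmorphB/= -!dotC.
Qed.

Lemma dotDr x y z : D x -> D y -> D z -> dot x (y + z) = dot x y + dot x z.
Proof.
move=> Dx Dy Dz; rewrite dotC//; last exact: inner_onD.
by rewrite dotDl// rmorphD/= -!dotC.
Qed.

Lemma dotZr a x z : D x -> D z -> dot x (a *: z) = a^* * dot x z.
Proof.
move=> Dx Dz; rewrite dotC//; last exact: inner_onZ.
by rewrite dotZl// rmorphM/= -dotC.
Qed.

Lemma dot_suml (I : Type) (s : seq I) (f : I -> V) z :
  (forall i, D (f i)) -> D z ->
  dot (\sum_(i <- s) f i) z = \sum_(i <- s) dot (f i) z.
Proof.
move=> Df Dz; elim: s => [|i s ih]; first by rewrite !big_nil dot0l.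
by rewrite !big_cons dotDl ?ih//; exact: inner_on_sum.
Qed.

Lemma dot_sumr (I : Type) (s : seq I) (f : I -> V) z :
  (forall i, D (f i)) -> D z ->
  dot z (\sum_(i <- s) f i) = \sum_(i <- s) dot z (f i).
Proof.
move=> Df Dz; rewrite dotC//; last exact: inner_on_sum.
rewrite dot_suml// rmorph_sum/=; apply: eq_bigr => i _.
by rewrite -dotC.
Qed.

Definition orthonormal_seq (s : seq V) :=
  uniq s /\ forall x y, x \in s -> y \in s -> dot x y = (x == y)%:R.

Definition proj (s : seq V) (w : V) := \sum_(e <- s) dot w e *: e.

Section Projection.
Variables (s : seq V) (w : V).
Hypotheses (sD : forall x, x \in s -> D x) (hs : orthonormal_seq s) (Dw : D w).

Let f e : V := if e \in s then dot w e *: e else 0.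

Let Df e : D (f e).
Proof. by rewrite /f; case: ifP => // /sD De; exact: inner_onZ. Qed.

Let projE : proj s w = \sum_(e <- s) f e.
Proof. by rewrite /proj big_seq [RHS]big_seq; apply: eq_bigr => e es; rewrite /f es. Qed.

Lemma proj_in : D (proj s w).
Proof. by rewrite projE; exact: inner_on_sum. Qed.

Lemma dot_proj e : e \in s -> dot (proj s w) e = dot w e.
Proof.
move=> es; have De := sD es; rewrite projE dot_suml//.
rewrite (bigD1_seq e)//=; last by case: hs.
rewrite /f es dotZl ?(hs.2 _ _ es es) ?eqxx ?mulr1//.
rewrite big_seq_cond big1 ?addr0// => i /andP[iis ine].
by have Di := sD iis; rewrite iis dotZl// (hs.2 _ _ iis es) (negbTE ine) mulr0.
Qed.

Lemma dot_residue e : e \in s -> dot (w - proj s w) e = 0.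
Proof.
by move=> es; rewrite dotBl ?dot_proj ?subrr//; [exact: proj_in|exact: sD].
Qed.

Lemma dot_residue_proj v : D v ->
  dot (w - proj s w) (proj s v) = 0.
Proof.
move=> Dv; have Dr := inner_onB Dw proj_in.
have -> : proj s v = \sum_(e <- s) (if e \in s then dot v e *: e else 0).
  by rewrite /proj big_seq [RHS]big_seq; apply: eq_bigr => e ->.
rewrite dot_sumr//; last first.
  by move=> e; case: ifP => // /sD De; exact: inner_onZ.
rewrite big_seq big1// => e es; rewrite es dotZr ?dot_residue ?mulr0//.
exact: sD.
Qed.

Lemma dot_self_proj :
  dot (proj s w) (proj s w) = \sum_(e <- s) `|dot w e| ^+ 2.
Proof.
rewrite {2}projE dot_sumr//; last exact: proj_in.
rewrite big_seq [RHS]big_seq; apply: eq_bigr => e es.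
rewrite /f es dotZr ?dot_proj ?normCK//; [exact: mulrC|exact: proj_in|exact: sD].
Qed.

(** Pythagoras: the residue of the projection measures the defect in Bessel's
    inequality. *)
Lemma bessel_eq :
  dot (w - proj s w) (w - proj s w) =
  dot w w - \sum_(e <- s) `|dot w e| ^+ 2.
Proof.
have Dp := proj_in; have Dr := inner_onB Dw Dp.
rewrite {1}dotBr// dot_residue_proj// subr0 dotBl// -dot_self_proj.
congr (_ - _); have := dot_residue_proj Dw; rewrite dotBl// => /eqP.
rewrite subr_eq0 => /eqP wpp; rewrite dotC// wpp.
by rewrite -dotC.
Qed.

Lemma best_approx (y : V) : D y -> dot (w - proj s w) y = 0 ->
  dot (w - proj s w) (w - proj s w) <= dot (w - y) (w - y).
Proof.
move=> Dy ry; have Dp := proj_in; have Dr := inner_onB Dw Dp.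
have Dpy := inner_onB Dp Dy.
have -> : w - y = (w - proj s w) + (proj s w - y) by rewrite addrA subrK.
have o : dot (w - proj s w) (proj s w - y) = 0.
  by rewrite dotBr// dot_residue_proj// ry subrr.
have o' : dot (proj s w - y) (w - proj s w) = 0 by rewrite dotC// o conjC0.
move: (w - _) (proj s w - y) Dr Dpy o o' => r z Dr Dz o o'.
have Drz := inner_onD Dr Dz.
rewrite [leRHS]dotDl// !dotDr// o o' addr0 add0r.
by rewrite lerDl dot_ge0.
Qed.

End Projection.

(** A finite set J of basis vectors supporting a good approximation of w does
    at least as well through its projection, and so does any larger set: the
    partial sums over such sets are within the error of |w|^2. *)
Lemma parseval (E : set V) (w : V) : orthonormal_basis dot D E -> D w ->
  summability.partial_sum (fun e : set_type E => `|dot w (val e)| ^+ 2 : R[i]^o)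
    @ summability.totally --> (dot w w : R[i]^o).
Proof.
move=> [ED Eon Ed] Dw.
have sumE (J : {fset set_type E}) :
    summability.partial_sum (fun e : set_type E => `|dot w (val e)| ^+ 2 : R[i]^o) J
    = \sum_(e <- [seq val e | e <- enum_fset J]) `|dot w e| ^+ 2.
  by rewrite /summability.partial_sum big_map (big_seq_fsetE _ _ xpredT).
have Jon (J : {fset set_type E}) : orthonormal_seq [seq val e | e <- enum_fset J].
  split; first by rewrite map_inj_uniq//; exact: val_inj.
  by move=> x y /mapP[a aJ ->] /mapP[b bJ ->]; apply: Eon;
    [move: (valP a)|move: (valP b)]; rewrite inE.
have JD (J : {fset set_type E}) x : x \in [seq val e | e <- enum_fset J] -> D x.
  by move=> /mapP[a aJ ->]; apply: ED; move: (valP a); rewrite inE.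
apply/cvgrPdist_lt => e e0.
have [y [m [c [v [Ev yE]]]] wy] := Ed _ Dw _ e0.
pose v' i : set_type E := SigSub (mem_set (Ev i)).
exists [fset v' i | i in 'I_m]%fset => // J /= /fsubsetP JJ.
rewrite sumE -(bessel_eq (JD J) (Jon J) Dw) ger0_norm; last first.
  by rewrite dot_ge0//; apply: inner_onB => //; apply: proj_in => //; exact: JD.
apply: le_lt_trans wy; apply: best_approx => //.
- exact: JD.
- by rewrite yE; apply: inner_on_sum => i; apply: inner_onZ; exact: ED.
- rewrite yE dot_sumr//.
  + rewrite big1// => i _; rewrite dotZr ?dot_residue ?mulr0//.
    * exact: JD.
    * apply/mapP; exists (v' i) => //.
      by apply: JJ; apply/imfsetP; exists i.
    * by apply: inner_onB => //; apply: proj_in => //; exact: JD.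
    * exact: ED.
  + by move=> i; apply: inner_onZ; exact: ED.
  + by apply: inner_onB => //; apply: proj_in => //; exact: JD.
Qed.

(** Parseval makes the trace of the sum of the operators <., f i> f i equal to
    the sum of the |f i|^2, whichever basis computes it.  The operator is only
    known through its quadratic form, which is what both uses provide. *)
Lemma trace_frame (I : eqType) (A : V -> V) (s : seq I) (f : I -> V) :
  (forall i, i \in s -> D (f i)) -> (exists E, orthonormal_basis dot D E) ->
  (forall e, D e -> dot (A e) e = \sum_(i <- s) `|dot (f i) e| ^+ 2) ->
  trace dot D A = \sum_(i <- s) dot (f i) (f i).
Proof.
move=> Df exE Ae; rewrite /trace.
set E := xget _ _; have hE : orthonormal_basis dot D E.
  by rewrite /E; case: xgetP => // no; have [E' hE'] := exE; have := no E'.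
rewrite /summability.sum; apply: (@cvg_lim R[i]^o); first exact: norm_hausdorff.
have -> : (fun e : set_type E => dot (A (val e)) (val e) : R[i]^o) =
          (fun e => \sum_(i <- s) `|dot (f i) (val e)| ^+ 2).
  apply/funext => e; apply: Ae; case: hE => ED _ _; apply: ED.
  by move: (valP e); rewrite inE.
rewrite [X in X @ _](_ : _ = (fun J => \sum_(i <- s)
    summability.partial_sum (fun e : set_type E => `|dot (f i) (val e)| ^+ 2 : R[i]^o) J));
  last first.
  by apply/funext => J; rewrite /summability.partial_sum exchange_big.
by apply: cvg_sum_seq => i /Df Dfi; exact: parseval.
Qed.

End InnerOn.

(** * Spans, dimension and Gram-Schmidt orthonormalization *)

Section LinSpan.
Context {R : realType} {V : lmodType R[i]}.
Implicit Types (S : set V) (x y : V).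

Lemma lin_span_sub S : S `<=` lin_span S.
Proof.
move=> x Sx; exists 1%N, (fun=> 1), (fun=> x); split => //.
by rewrite big_ord1 scale1r.
Qed.

Lemma lin_span0 S : lin_span S 0.
Proof.
exists 0%N, (fun=> 1), (fun=> 0); split; first by case.
by rewrite big_ord0.
Qed.

Lemma lin_spanD S x y : lin_span S x -> lin_span S y -> lin_span S (x + y).
Proof.
move=> [m [c [v [Sv ->]]]] [p [d [w [Sw ->]]]].
exists (m + p)%N, (fun i => match fintype.split i with inl j => c j | inr j => d j end),
  (fun i => match fintype.split i with inl j => v j | inr j => w j end); split.
  by move=> i; case: (fintype.split i).
rewrite big_split_ord/=; congr (_ + _); apply: eq_bigr => i _.
  by rewrite (unsplitK (inl _ i)).
by rewrite (unsplitK (inr _ i)).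
Qed.

Lemma lin_spanZ S a x : lin_span S x -> lin_span S (a *: x).
Proof.
move=> [m [c [v [Sv ->]]]]; exists m, (fun i => a * c i), v; split => //.
by rewrite scaler_sumr; apply: eq_bigr => i _; rewrite scalerA.
Qed.

Lemma lin_spanB S x y : lin_span S x -> lin_span S y -> lin_span S (x - y).
Proof.
by move=> Sx Sy; apply: lin_spanD => //; rewrite -scaleN1r; exact: lin_spanZ.
Qed.

Lemma lin_span_sum S (I : eqType) (s : seq I) (f : I -> V) :
  (forall i, i \in s -> lin_span S (f i)) -> lin_span S (\sum_(i <- s) f i).
Proof.
elim: s => [|i s ih] Sf; first by rewrite big_nil; exact: lin_span0.
rewrite big_cons; apply: lin_spanD; first by apply: Sf; rewrite mem_head.
by apply: ih => j js; apply: Sf; rewrite inE js orbT.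
Qed.

Lemma lin_span_min S S' : S `<=` lin_span S' -> lin_span S `<=` lin_span S'.
Proof.
move=> SS' x [m [c [v [Sv ->]]]]; apply: lin_span_sum => i _.
by apply: lin_spanZ; exact: SS'.
Qed.

Lemma lin_span_eq S S' : S `<=` lin_span S' -> S' `<=` lin_span S ->
  lin_span S = lin_span S'.
Proof. by move=> SS' S'S; apply/seteqP; split; exact: lin_span_min. Qed.

Lemma lin_span_ind S (P : V -> Prop) : P 0 ->
  (forall a x y, S x -> P y -> P (a *: x + y)) ->
  forall x, lin_span S x -> P x.
Proof.
move=> P0 PD x [m [c [v [Sv ->]]]].
by elim: (index_enum _) => [|i s ih]; rewrite ?big_nil// big_cons; exact: PD.
Qed.

(** With more vectors than generators, the coefficient matrix has a nonzero
    left kernel, whose elements are linear relations. *)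
Lemma lin_independent_leq d e (b : 'I_d -> V) (c : 'I_e -> V) :
  lin_independent b -> (forall i, lin_span (range c) (b i)) -> (d <= e)%N.
Proof.
move=> bfree bc.
have bA i : exists a : 'I_e -> R[i], b i = \sum_j a j *: c j.
  move: (bc i); move: (b i) => bi; move: bi; apply: lin_span_ind.
    by exists (fun=> 0); rewrite big1// => j _; rewrite scale0r.
  move=> a x y [j0 _ <-] [y' ->]; exists (fun j => (j == j0)%:R * a + y' j).
  under [RHS]eq_bigr do rewrite scalerDl; rewrite big_split/=; congr (_ + _).
  rewrite (bigD1 j0)//= eqxx mul1r big1 ?addr0// => j /negbTE ->.
  by rewrite mul0r scale0r.
have [A bE] := choice bA.
pose M := \matrix_(i < d, j < e) A i j.
case: leqP => // ed.
have kn0 : kermx M != 0.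
  by rewrite kermx_eq0 -row_leq_rank -ltnNge (leq_ltn_trans _ ed)// rank_leq_col.
have [i ki] : exists i, row i (kermx M) != 0.
  apply/existsP; rewrite -negb_forall; apply: contra kn0 => /forallP k0.
  apply/eqP/row_matrixP => i; rewrite row0; exact/eqP/k0.
set u := row i _ in ki.
have uM : u *m M = 0 by apply/sub_kermxP; exact: row_sub.
case/negP: ki; apply/eqP/rowP => j; rewrite [RHS]mxE; move: j.
apply: (bfree (fun j => u 0 j)).
under eq_bigr => k _ do rewrite bE scaler_sumr.
rewrite exchange_big big1//= => l _.
have /rowP/(_ l) := uM; rewrite !mxE => ul.
under eq_bigr => k _ do rewrite scalerA.
rewrite -scaler_suml -[X in X *: _](_ : 0 = _) ?scale0r//.
by rewrite -[LHS]ul; apply: eq_bigr => k _; rewrite [M _ _]mxE.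
Qed.

Lemma dim_unique (M : set V) d : has_dim M d -> Defs.dim M = d.
Proof.
move=> Md; rewrite /Defs.dim; case: xgetP => [d' _ Md'|/(_ d)//].
have bM e f : has_dim M e -> has_dim M f -> (e <= f)%N.
  move=> [b [bfree bE]] [c [_ cE]]; apply: (lin_independent_leq bfree (c := c)).
  by move=> i; rewrite cE -bE; apply: lin_span_sub; exists i.
by apply/eqP; rewrite eqn_leq !bM.
Qed.

End LinSpan.

Section GramSchmidt.
Context {R : realType} {H : hilbertType R}.

Lemma inner_inner_on : inner_on (inner : H -> H -> R[i]) setT.
Proof.
split => //.
- by move=> a x y z _ _ _; rewrite linearDl linearZl_LR.
- by move=> x y _ _; rewrite hermC expr0 mul1r.
Qed.

Lemma innerC (x y : H) : inner x y = (inner y x)^*.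
Proof. by rewrite (dotC inner_inner_on). Qed.

Lemma inner_ge0 (x : H) : 0 <= inner x x.
Proof. exact: (dot_ge0 inner_inner_on). Qed.

Lemma inner_eq0 (x : H) : inner x x = 0 -> x = 0.
Proof. by rewrite inner_norm => /eqP; rewrite sqrf_eq0 normr_eq0 => /eqP. Qed.

Lemma inner_gt0 (x : H) : x != 0 -> 0 < inner x x.
Proof. by move=> x0; rewrite inner_norm exprn_gt0// normr_gt0. Qed.

Lemma inner_eq (x y : H) : (forall u, inner u x = inner u y) -> x = y.
Proof.
move=> xy; apply/eqP; rewrite -subr_eq0; apply/eqP/inner_eq0.
by rewrite linearBr/= xy subrr.
Qed.

Lemma innerZr a (x y : H) : inner x (a *: y) = a^* * inner x y.
Proof. by rewrite linearZr_LR. Qed.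

Definition gram_schmidt_step (b : seq H) (x : H) : seq H :=
  let r := x - proj inner b x in
  if r == 0 then b else rcons b (`|r|^-1 *: r).

Definition gram_schmidt (s : seq H) : seq H := foldl gram_schmidt_step [::] s.

Lemma gram_schmidt_rcons s x : gram_schmidt (rcons s x) = gram_schmidt_step (gram_schmidt s) x.
Proof. by rewrite /gram_schmidt foldl_rcons. Qed.

Lemma proj_span (b : seq H) x : lin_span [set` b] (proj inner b x).
Proof.
by apply: lin_span_sum => e eb; apply: lin_spanZ; exact: lin_span_sub.
Qed.

Lemma gram_schmidt_orthonormal s : orthonormal_seq inner (gram_schmidt s).
Proof.
elim/last_ind: s => [|s x [ub ob]]; first by split.
rewrite gram_schmidt_rcons /gram_schmidt_step.
set b := gram_schmidt s in ub ob *; set r := x - _.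
case: eqVneq => // r0.
have rb e : e \in b -> inner r e = 0.
  by move=> eb; apply: (dot_residue inner_inner_on).
have re e : e \in b -> inner (`|r|^-1 *: r) e = 0.
  by move=> eb; rewrite linearZl_LR/= rb// mulr0.
have rr : inner (`|r|^-1 *: r) (`|r|^-1 *: r) = 1.
  rewrite linearZl_LR/= innerZr inner_norm conj_Creal; last first.
    by rewrite realV normr_real.
  by rewrite mulrA -expr2 exprVn mulVf// expf_neq0// normr_eq0.
have nb : `|r|^-1 *: r \notin b.
  by apply/negP => /re; rewrite rr => /eqP; rewrite oner_eq0.
split; first by rewrite rcons_uniq nb.
move=> y z; rewrite !mem_rcons !inE => /predU1P[->|yb] /predU1P[->|zb].
- by rewrite eqxx rr.
- by rewrite re//; case: eqVneq zb nb => // -> ->.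
- by rewrite innerC re// conjC0; case: eqVneq yb nb => // -> ->.
- exact: ob.
Qed.

Lemma gram_schmidt_span s : lin_span [set` gram_schmidt s] = lin_span [set` s].
Proof.
elim/last_ind: s => [//|s x ih].
have ss : lin_span [set` gram_schmidt s] `<=` lin_span [set` rcons s x].
  rewrite ih; apply: lin_span_min => y /= ys; apply: lin_span_sub.
  by rewrite /= mem_rcons inE ys orbT.
have gss : lin_span [set` gram_schmidt s] `<=` lin_span [set` gram_schmidt (rcons s x)].
  apply: lin_span_min => y /= ys; apply: lin_span_sub => /=.
  by rewrite gram_schmidt_rcons /gram_schmidt_step; case: ifP => // _;
    rewrite mem_rcons inE ys orbT.
have px := proj_span (gram_schmidt s) x.
apply: lin_span_eq => y /=.
  rewrite gram_schmidt_rcons /gram_schmidt_step; case: ifP => [_ ys|_].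
    by apply: ss; exact: lin_span_sub.
  rewrite mem_rcons inE => /predU1P[->|ys]; last by apply: ss; exact: lin_span_sub.
  apply/lin_spanZ/lin_spanB; last exact: ss.
  by apply: lin_span_sub; rewrite /= mem_rcons mem_head.
rewrite mem_rcons inE => /predU1P[->|ys]; last first.
  by apply: gss; rewrite ih; exact: lin_span_sub.
rewrite -[X in lin_span _ X](subrK (proj inner (gram_schmidt s) x)).
apply: lin_spanD; last exact: gss.
rewrite gram_schmidt_rcons /gram_schmidt_step; case: eqVneq => [->|r0]; first exact: lin_span0.
set r := x - _ in r0 *.
have n0 : `|r| != 0 by rewrite normr_eq0.
rewrite -[X in lin_span _ X](scalerKV n0 r); apply: lin_spanZ.
by apply: lin_span_sub; rewrite /= mem_rcons mem_head.
Qed.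

(** Appending vectors never changes the part of the basis already built. *)
Lemma gram_schmidt_cat s t x : x \in gram_schmidt s -> x \in gram_schmidt (s ++ t).
Proof.
elim/last_ind: t => [|t y ih]; first by rewrite cats0.
move=> /ih xst; rewrite -rcons_cat gram_schmidt_rcons /gram_schmidt_step; case: ifP => // _.
by rewrite mem_rcons inE xst orbT.
Qed.

Lemma proj_id (b : seq H) x : orthonormal_seq inner b -> lin_span [set` b] x ->
  proj inner b x = x.
Proof.
move=> ob; move: x; apply: lin_span_ind => [|a y z yb zE].
  by rewrite /proj big1// => e _; rewrite linear0l scale0r.
rewrite -[in RHS]zE /proj; under eq_bigr do
  rewrite linearDl linearZl_LR/= scalerDl.
rewrite big_split/=; congr (_ + _).
rewrite (bigD1_seq y)//=; last by case: ob.
rewrite (ob.2 _ _ yb yb) eqxx mulr1 big_seq_cond big1 ?addr0// => i /andP[ib iy].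
by rewrite (ob.2 _ _ yb ib) eq_sym (negbTE iy) mulr0 scale0r.
Qed.

Lemma orthonormal_has_dim (b : seq H) : orthonormal_seq inner b ->
  has_dim (lin_span [set` b]) (size b).
Proof.
move=> ob; exists (tnth (in_tuple b)); split; last first.
  congr lin_span; apply/seteqP; split => x /=.
    by move=> [i _ <-]; exact: mem_tnth.
  by move=> /(tnthP (in_tuple b))[i ->]; exists i.
move=> c c0 i.
have := congr1 (fun z => inner z (tnth (in_tuple b) i)) c0.
rewrite linear0l linear_sumlz (bigD1 i)//= linearZl_LR/=.
rewrite ob.2 ?eqxx ?mulr1 ?big1 ?addr0//; first last.
- exact: (mem_tnth i (in_tuple b)).
- exact: (mem_tnth i (in_tuple b)).
move=> j ji; rewrite linearZl_LR/= ob.2; first last.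
- exact: (mem_tnth i (in_tuple b)).
- exact: (mem_tnth j (in_tuple b)).
rewrite !(tnth_nth 0)/= nth_uniq//; last by case: ob.
by rewrite -[(_ == _)%N]/(j == i) (negbTE ji) mulr0.
Qed.

(** The orthonormalizations of longer and longer concatenations of the lists
    form an increasing chain; its union inherits density from the lists. *)
Lemma exists_onb (L : nat -> seq H) :
  (forall h (e : R[i]), 0 < e -> exists N y,
     lin_span [set` L N] y /\ inner (h - y) (h - y) < e) ->
  exists E, orthonormal_basis inner [set: H] E.
Proof.
move=> Ld; pose F N := flatten [seq L i | i <- iota 0 N].
exists [set x | exists N, x \in gram_schmidt (F N)].
have Fsub N M x : (N <= M)%N -> x \in gram_schmidt (F N) -> x \in gram_schmidt (F M).
  move=> /subnKC <- xN; rewrite /F iotaD map_cat flatten_cat; exact: gram_schmidt_cat.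
split => //.
- move=> x y [N xN] [M yM].
  apply: (gram_schmidt_orthonormal (F (maxn N M))).2.
    by apply: Fsub xN; exact: leq_maxl.
  by apply: Fsub yM; exact: leq_maxr.
- move=> h _ e /(Ld h)[N [y [yL hy]]]; exists y => //.
  suff : lin_span [set` gram_schmidt (F N.+1)] y.
    apply: lin_span_min => x /= xN; apply: lin_span_sub; by exists N.+1.
  rewrite gram_schmidt_span; move: y yL {hy}; apply: lin_span_min => x /= xL.
  apply: lin_span_sub => /=; apply/flattenP; exists (L N) => //.
  by apply: map_f; rewrite mem_iota/= add0n ltnSn.
Qed.

(** The frame identity on the span makes the sum of the rank one operators
    given by the vectors of the frame the identity there, so that its trace,
    computed in an orthonormal basis of the span, is the dimension. *)
Lemma dim_frame (I : eqType) (s : seq I) (f : I -> H) :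
  (forall x, lin_span [set` map f s] x ->
     \sum_(i <- s) `|inner x (f i)| ^+ 2 = inner x x) ->
  (Defs.dim (lin_span [set` map f s]))%:R = \sum_(i <- s) inner (f i) (f i).
Proof.
move=> sf; have ob := gram_schmidt_orthonormal (map f s).
rewrite (dim_unique (d := size (gram_schmidt (map f s)))); last first.
  by rewrite -gram_schmidt_span; exact: orthonormal_has_dim.
transitivity (\sum_(e <- gram_schmidt (map f s)) inner e e).
  rewrite big_seq; under eq_bigr => e eb do rewrite (ob.2 _ _ eb eb) eqxx.
  by rewrite -big_seq big_const_seq count_predT iter_addr addr0.
transitivity (\sum_(e <- gram_schmidt (map f s)) \sum_(i <- s) `|inner e (f i)| ^+ 2).
  rewrite big_seq [RHS]big_seq; apply: eq_bigr => e eb; rewrite sf//.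
  by rewrite -gram_schmidt_span; exact: lin_span_sub.
rewrite exchange_big/= big_seq [RHS]big_seq; apply: eq_bigr => i si.
have fi : proj inner (gram_schmidt (map f s)) (f i) = f i.
  by apply: proj_id => //; rewrite gram_schmidt_span; apply: lin_span_sub; exact: map_f.
rewrite -[in RHS]fi (dot_self_proj inner_inner_on)//.
by apply: eq_bigr => e _; rewrite innerC norm_conjC.
Qed.

End GramSchmidt.

(** * Unordered sums and square-summable families *)

Lemma cvg_lincomb (K : numFieldType) (V : normedModType K) T
    (F : set_system T) (FF : Filter F) (f g : T -> V) a l m :
  f x @[x --> F] --> l -> g x @[x --> F] --> m ->
  a *: f x + g x @[x --> F] --> a *: l + m.
Proof. by move=> fl gm; apply: cvgD => //; apply: cvgZ => //; exact: cvg_cst. Qed.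

Section UnorderedSums.
Context {R : realType} {I : choiceType}.
Local Notation psum x := (summability.partial_sum (x : I -> R[i]^o)).

Lemma psumE (x : I -> R[i]) J : psum x J = \sum_(i <- enum_fset J) x i.
Proof. by rewrite /summability.partial_sum -(big_seq_fsetE _ _ xpredT). Qed.

Lemma le_sum_fset (x : I -> R[i]) (J K : {fset I}) : (forall i, 0 <= x i) ->
  (J `<=` K)%fset -> \sum_(i <- J) x i <= \sum_(i <- K) x i.
Proof.
move=> x0 JK; rewrite [leRHS](big_fsetID _ (mem J))/=.
rewrite (_ : [fset i | i in K & i \in J]%fset = J); last first.
  apply/fsetP => i; rewrite !inE/= andbC.
  by case: (boolP (i \in J)) => //= /(fsubsetP JK) ->.
by rewrite lerDl sumr_ge0.
Qed.

Lemma nonneg_psum_cvg (x : I -> R[i]) (M : R[i]) : (forall i, 0 <= x i) ->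
  (forall J : {fset I}, \sum_(i <- J) x i <= M) ->
  exists2 l : R[i], 0 <= l & psum x @ summability.totally --> (l : R[i]^o).
Proof.
move=> x0 xM; pose S (J : {fset I}) := \sum_(i <- J) x i.
have S0 J : 0 <= S J by exact: sumr_ge0.
have SRe J : S J = (complex.Re (S J))%:C%C.
  by rewrite RRe_real// ger0_real.
pose X := range (fun J => complex.Re (S J)).
have hX : has_sup X.
  split; first by exists (complex.Re (S fset0)); exists fset0.
  exists (complex.Re M) => _ [J _ <-].
  by have := xM J; rewrite lecE => /andP[].
have Xub J : complex.Re (S J) <= sup X.
  by apply: ub_le_sup; [case: hX|exists J].
exists (sup X)%:C%C.
  rewrite ler0c; apply: le_trans (Xub fset0).
  by have := S0 fset0; rewrite lecE => /andP[].
apply/cvgrPdist_lt => e e0.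
have eE : e = (complex.Re e)%:C%C by rewrite RRe_real// gtr0_real.
have re0 : 0 < complex.Re e by rewrite -ltcR -eE.
have [_ [J0 _ <-] SJ0] := sup_adherent re0 hX.
exists J0 => // J /= J0J; rewrite psumE -/(S J) SRe -rmorphB/=.
have SJ : complex.Re (S J0) <= complex.Re (S J).
  by have := le_sum_fset x0 J0J; rewrite lecE => /andP[].
rewrite ger0_norm; last by rewrite ler0c subr_ge0.
by rewrite eE ltcR ltrBlDr -ltrBlDl (lt_le_trans SJ0).
Qed.

Lemma psum_lim (x : I -> R[i]) (l : R[i]) :
  psum x @ summability.totally --> (l : R[i]^o) ->
  summability.sum (x : I -> R[i]^o) = l.
Proof. by apply: (@cvg_lim R[i]^o); exact: norm_hausdorff. Qed.

Lemma psum_finsupp (x : I -> R[i]) (s : seq I) : uniq s ->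
  (forall i, i \notin s -> x i = 0) ->
  psum x @ summability.totally --> (\sum_(i <- s) x i : R[i]^o).
Proof.
move=> us xs; apply: cvg_near_cst; exists [fset i in s]%fset => // J /= sJ.
rewrite psumE (bigID (mem s))/= [X in _ + X]big1 ?addr0//.
rewrite -big_filter; apply: perm_big; apply: uniq_perm => //.
  exact/filter_uniq/fset_uniq.
move=> i; rewrite mem_filter; case: (boolP (i \in s)) => //= si.
by apply: (fsubsetP sJ); rewrite inE.
Qed.

Lemma psumD (x y : I -> R[i]) (a l m : R[i]) :
  psum x @ summability.totally --> (l : R[i]^o) ->
  psum y @ summability.totally --> (m : R[i]^o) ->
  psum (fun i => a * x i + y i) @ summability.totally --> (a * l + m : R[i]^o).
Proof.
move=> xl ym; rewrite (_ : psum _ = fun J => a * psum x J + psum y J); last first.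
  apply/funext => J; rewrite !psumE big_split/=; congr (_ + _).
  by rewrite mulr_sumr.
exact: (@cvg_lincomb R[i] R[i]^o _ _ summability.totally_filter
  (psum x) (psum y) a l m xl ym).
Qed.

End UnorderedSums.

Section Ell2.
Context {R : realType} {I : choiceType}.
Local Notation psum x := (summability.partial_sum (x : I -> R[i]^o)).
Let cdot (a b : R[i]^o) : R[i] := a * b^*.
Local Notation ell2C := (@ell2 R R[i]^o cdot setT I).
Local Notation "<[ f , g ]>" := (@ell2_dot R R[i]^o cdot I f g).

Lemma ell2_dot_diag (f : I -> R[i]^o) : ell2C f ->
  exists2 l : R[i], 0 <= l &
    psum (fun i => cdot (f i) (f i)) @ summability.totally --> (l : R[i]^o).
Proof.
by move=> [_ [M fM]]; apply: nonneg_psum_cvg fM => i; rewrite /cdot mul_conjC_ge0.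
Qed.

Lemma ell2P a (f g : I -> R[i]^o) : ell2C f -> ell2C g -> ell2C (a *: f + g).
Proof.
move=> [_ [M fM]] [_ [N gN]]; split => //.
exists (2 * (`|a| ^+ 2 * M) + 2 * N) => J.
apply: (@le_trans _ _ (2 * (`|a| ^+ 2 * \sum_(i <- J) cdot (f i) (f i)) +
                       2 * \sum_(i <- J) cdot (g i) (g i))); last first.
  by rewrite lerD// ler_wpM2l// ler_wpM2l// exprn_ge0.
rewrite !mulr_sumr -big_split/=; apply: ler_sum => i _.
have eD : (a *: f + g) i = a * f i + g i by [].
rewrite eD /cdot -!normCK -[X in 2 * X + _]exprMn -normrM.
set u := a * f i; set v := g i.
rewrite -mulrDr -subr_ge0.
(* The bound is the parallelogram law with |u - v|^2 dropped. *)
suff -> : 2 * (`|u| ^+ 2 + `|v| ^+ 2) - `|u + v| ^+ 2 = `|u - v| ^+ 2.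
  by rewrite exprn_ge0.
rewrite !normCK !rmorphD !rmorphN/=; ring.
Qed.

(** Polarization expresses f i (g i)^* through |f + c g|^2 with c a fourth root
    of unity, hence through nonnegative families with bounded partial sums. *)
Lemma ell2_dot_cvg (f g : I -> R[i]^o) : ell2C f -> ell2C g ->
  psum (fun i => cdot (f i) (g i)) @ summability.totally --> (<[f, g]> : R[i]^o).
Proof.
move=> lf lg.
suff [l fgl] : exists l : R[i],
    psum (fun i => cdot (f i) (g i)) @ summability.totally --> (l : R[i]^o).
  by rewrite /ell2_dot (psum_lim fgl).
have [p _ fp] := ell2_dot_diag (ell2P 1 lf lg).
have [q _ fq] := ell2_dot_diag (ell2P (-1) lf lg).
have [r _ fr] := ell2_dot_diag (ell2P 'i lg lf).
have [s _ fs] := ell2_dot_diag (ell2P (- 'i) lg lf).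
exists (4^-1 * (1 * p + (-1 * q + ('i * r + (- 'i * s + 0))))).
have z : psum (fun=> 0) @ summability.totally --> ((0 : R[i]) : R[i]^o).
  by move: (@psum_finsupp R I (fun=> 0) [::] isT (fun _ _ => erefl)); rewrite big_nil.
have := psumD (a := 4^-1) (psumD (a := 1) fp (psumD (a := -1) fq
  (psumD (a := 'i) fr (psumD (a := - 'i) fs z)))) z.
set F := (X in psum X @ _ --> _); set l := (X in _ --> X).
suff FE : F = fun i => cdot (f i) (g i) by rewrite FE /l addr0.
apply/funext => i; rewrite /F.
have E a (u v : I -> R[i]^o) : (a *: u + v) i = a * u i + v i by [].
rewrite !E /cdot !rmorphD/= !rmorphM/= !rmorphN/= conjCi conjC1 !addr0.
move: (sqrCi R[i]); set c : R[i] := 'i => c2.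
move: (f i : R[i]) (g i : R[i]) => u v.
transitivity (4^-1 * (2 * (u * v^* + v * u^*) + 2 * c ^+ 2 * (v * u^* - u * v^*))).
  ring.
by rewrite c2; field.
Qed.

Lemma ell2_inner_on : inner_on (ell2_dot cdot (I:=I)) ell2C.
Proof.
split.
- by split => //; exists 0 => J; rewrite big1// => i _; rewrite /cdot mul0r.
- exact: ell2P.
- move=> a f g h lf lg lh; apply: psum_lim.
  have := psumD (a := a) (ell2_dot_cvg lf lh) (ell2_dot_cvg lg lh).
  rewrite [X in psum X @ _ --> _ -> _](_ : _ = fun i => cdot ((a *: f + g) i) (h i))//.
  apply/funext => i.
  have -> : (a *: f + g) i = a * f i + g i by [].
  by rewrite /cdot mulrDl mulrA.
- move=> f g lf lg; apply: psum_lim.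
  have /cvgrPdist_lt gf := ell2_dot_cvg lg lf.
  apply/cvgrPdist_lt => e /gf; apply: filterS => J.
  set x := (X in X < e -> _); set y := (X in _ -> X < e).
  suff -> : x = y by [].
  rewrite /x /y -[LHS]norm_conjC rmorphB/=; congr (`|_ - _|).
  rewrite !psumE rmorph_sum; apply: eq_bigr => i _.
  by rewrite /cdot rmorphM/= conjCK mulrC.
- move=> f lf; have [l l0 fl] := ell2_dot_diag lf.
  by rewrite /ell2_dot (psum_lim fl).
Qed.

Definition ell2_delta (i : I) : I -> R[i]^o := fun j => (j == i)%:R.

Lemma ell2_delta_in i : ell2C (ell2_delta i).
Proof.
split => //; exists 1 => J.
apply: (@le_trans _ _ (count_mem i J)%:R); last first.
  by rewrite -[leRHS]/(1%:R) ler_nat count_uniq_mem ?fset_uniq// leq_b1.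
rewrite -sum1_count natr_sum [leRHS]big_mkcond/=; apply: ler_sum => j _.
by rewrite /cdot /ell2_delta conjC_nat -natrM mulnb andbb; case: ifP.
Qed.

Lemma ell2_dot_delta (f : I -> R[i]^o) i : <[f, ell2_delta i]> = f i.
Proof.
have fi j : j \notin [:: i] -> cdot (f j) (ell2_delta i j) = 0.
  by rewrite inE /cdot /ell2_delta => /negbTE ->; rewrite conjC0 mulr0.
rewrite /ell2_dot (psum_lim (psum_finsupp _ fi))// big_seq1 /cdot /ell2_delta.
by rewrite eqxx conjC1 mulr1.
Qed.

(** Truncating f to a finite set is projecting it on the corresponding delta
    functions, so by Pythagoras the error is the tail of the sum of |f i|^2. *)
Lemma ell2_delta_onb : orthonormal_basis (ell2_dot cdot (I:=I)) ell2C (range ell2_delta).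
Proof.
have dd i j : <[ell2_delta i, ell2_delta j]> = (ell2_delta i == ell2_delta j)%:R.
  rewrite ell2_dot_delta /ell2_delta; congr (nat_of_bool _)%:R.
  apply/eqP/eqP => [->//|/(congr1 (fun h => h j))]/=.
  by rewrite eqxx; case: eqP => // _ /eqP; rewrite eq_sym oner_eq0.
split.
- by move=> _ [i _ <-]; exact: ell2_delta_in.
- by move=> _ _ [i _ <-] [j _ <-]; exact: dd.
move=> f lf e e0; have /cvgrPdist_lt/(_ e e0)[J _ /(_ J)] := ell2_dot_cvg lf lf.
move=> /(_ (fsubset_refl _)) fJ.
have dinj : injective ell2_delta.
  move=> i j /(congr1 (fun h => h i)); rewrite /ell2_delta eqxx.
  by case: eqP => // _ /eqP; rewrite oner_eq0.
pose s := [seq ell2_delta i | i <- J].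
have sD x : x \in s -> ell2C x by move=> /mapP[i _ ->]; exact: ell2_delta_in.
have so : orthonormal_seq (ell2_dot cdot (I:=I)) s.
  split; first by rewrite map_inj_uniq// fset_uniq.
  by move=> _ _ /mapP[i _ ->] /mapP[j _ ->]; exact: dd.
exists (proj (ell2_dot cdot (I:=I)) s f).
  apply: lin_span_sum => x /mapP[i _ ->]; apply: lin_spanZ.
  by apply: lin_span_sub; exists i.
apply: le_lt_trans fJ.
rewrite (bessel_eq ell2_inner_on)// psumE big_map.
apply: le_trans (real_ler_norm _); last first.
  rewrite rpredB// ger0_real//; first exact: (dot_ge0 ell2_inner_on).
  by apply: sumr_ge0 => i _; rewrite /cdot mul_conjC_ge0.
rewrite lerB//; apply: ler_sum => i _.
by rewrite ell2_dot_delta normCK.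
Qed.

End Ell2.

Lemma fock_trace_card (R : realType) (k : nat) (n : 'I_k -> nat)
    (q : 'I_k -> nat) (s : seq (words (n:=n))) : uniq s ->
  (forall b : words (n:=n), (b \in s) = [forall i, size (b i) == q i]) ->
  @fock_trace R k n q = (size s)%:R.
Proof.
move=> us sq; rewrite /fock_trace.
rewrite (trace_frame (ell2_inner_on (I := words (n:=n))) (s := s)
  (f := @ell2_delta R _)).
- under eq_bigr do rewrite ell2_dot_delta /ell2_delta eqxx.
  by rewrite big_const_seq count_predT iter_addr addr0.
- by move=> b _; exact: ell2_delta_in.
- by exists (range (@ell2_delta R _)); exact: ell2_delta_onb.
move=> f lf.
have fs b : b \notin s -> @fock_proj R k n R[i]^o q f b * (f b)^* = 0.
  by rewrite sq /fock_proj => /negbTE ->; rewrite mul0r.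
transitivity (\sum_(b <- s) @fock_proj R k n R[i]^o q f b * (f b)^* : R[i]).
  exact: psum_lim (psum_finsupp us fs).
rewrite big_seq [RHS]big_seq; apply: eq_bigr => b bs.
rewrite (dotC ell2_inner_on)//; last exact: ell2_delta_in.
rewrite ell2_dot_delta norm_conjC normCK.
by rewrite /fock_proj -sq bs.
Qed.

(** * Riesz representation and existence of adjoints *)

(** The order on complex numbers is partial: the infimum is taken on real
    parts, which lose nothing for real values. *)
Lemma exists_approx_inf (R : realType) (T : Type) (F : T -> R[i]) (t0 : T) (b : R[i]) :
  (forall t, F t \is Num.real) -> (forall t, b <= F t) ->
  exists m : R[i], (forall t, m <= F t) /\
    forall e : R[i], 0 < e -> exists t, F t < m + e.
Proof.
move=> Fr bF; have FRe t : F t = (complex.Re (F t))%:C%C by rewrite RRe_real.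
pose X := range (fun t => complex.Re (F t)).
have hX : has_inf X.
  split; first by exists (complex.Re (F t0)), t0.
  exists (complex.Re b) => _ [t _ <-].
  by have := bF t; rewrite lecE => /andP[].
exists (inf X)%:C%C; split.
  move=> t; rewrite FRe lecR; apply: ge_inf; first by case: hX.
  by exists t.
move=> e e0; have eE : e = (complex.Re e)%:C%C by rewrite RRe_real// gtr0_real.
have re0 : 0 < complex.Re e by rewrite -ltcR -eE.
have [_ [t _ <-] Ft] := inf_adherent re0 hX.
by exists t; rewrite eE -rmorphD/= FRe ltcR.
Qed.

Lemma complex_lt_invSn (R : realType) (e : R[i]) : 0 < e ->
  exists N : nat, (N.+1%:R)^-1 < e.
Proof.
move=> e0; have eE : e = (complex.Re e)%:C%C by rewrite RRe_real// gtr0_real.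
have re0 : 0 < complex.Re e by rewrite -ltcR -eE.
have [N] := ltr_add_invr re0; rewrite add0r => Ne; exists N.
by rewrite eE -(rmorph_nat (real_complex R)) -fmorphV ltcR.
Qed.

Section Riesz.
Context {R : realType} {H : hilbertType R}.

Lemma cauchy_schwarz (x y : H) : `|inner x y| ^+ 2 <= inner x x * inner y y.
Proof.
have [->|y0] := eqVneq y 0.
  by rewrite [inner x 0]linear0r linear0l normr0 expr0n mulr0.
have yy : 0 < inner y y := inner_gt0 y0.
pose a := inner x y / inner y y.
have yr : (inner y y)^* = inner y y by rewrite conj_Creal// gtr0_real.
have : 0 <= inner (x - a *: y) (x - a *: y) by exact: inner_ge0.
rewrite linearBl/= !linearBr/= linearZl_LR/= !innerZr [inner (a *: y) y]linearZl_LR/=.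
rewrite (innerC y x) /a rmorphM/= fmorphV/= yr.
set u := inner x y; set t := inner y y in yy *; set s := inner x x.
have t0 : t != 0 by rewrite gt_eqF.
rewrite [X in 0 <= X -> _](_ : _ = s - u * u^* / t); last by field.
by rewrite subr_ge0 ler_pdivrMr// normCK.
Qed.

Lemma norm_inner_le (x y : H) : `|inner x y| <= `|x| * `|y|.
Proof.
rewrite -(ler_pXn2r (n := 2))// ?nnegrE ?mulr_ge0//.
by rewrite exprMn -!inner_norm cauchy_schwarz.
Qed.

Lemma innerDl (x y z : H) : inner (x + y) z = inner x z + inner y z.
Proof. exact: linearDl. Qed.
Lemma innerDr (x y z : H) : inner x (y + z) = inner x y + inner x z.
Proof. exact: linearDr. Qed.
Lemma innerBl (x y z : H) : inner (x - y) z = inner x z - inner y z.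
Proof. exact: linearBl. Qed.
Lemma innerBr (x y z : H) : inner x (y - z) = inner x y - inner x z.
Proof. exact: linearBr. Qed.
Lemma innerZl a (x y : H) : inner (a *: x) y = a * inner x y.
Proof. by rewrite linearZl_LR. Qed.

Lemma inner_suml (I : Type) (s : seq I) (f : I -> H) (y : H) :
  inner (\sum_(i <- s) f i) y = \sum_(i <- s) inner (f i) y.
Proof. exact: linear_sumlz. Qed.
Lemma inner_sumr (I : Type) (s : seq I) (f : I -> H) (y : H) :
  inner y (\sum_(i <- s) f i) = \sum_(i <- s) inner y (f i).
Proof. exact: linear_sumr. Qed.

Lemma inner_cvg (T : Type) (F : set_system T) (FF : Filter F) (u : T -> H) (l h : H) :
  u t @[t --> F] --> l -> inner (u t) h @[t --> F] --> (inner l h : R[i]^o).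
Proof.
move=> /cvgrPdist_lt ul; apply/cvgrPdist_lt => e e0.
have h1 : 0 < `|h| + 1 by rewrite ltr_wpDl.
have := ul _ (divr_gt0 e0 h1); apply: filterS => t lut.
rewrite -innerBl (le_lt_trans (norm_inner_le _ _))//.
rewrite (le_lt_trans (y := `|l - u t| * (`|h| + 1)))//.
  by rewrite ler_wpM2l// lerDl.
by rewrite -ltr_pdivlMr.
Qed.

(** The representing vector minimizes the convex functional
    |u|^2 - 2 Re f(u); the parallelogram law makes minimizing sequences
    Cauchy, and a perturbation of an almost minimizer u by a multiple of h
    bounds the difference of f h and <h, u>. *)
Lemma riesz (f : H -> R[i]) (C : R[i]) : 0 <= C ->
  (forall a x y, f (a *: x + y) = a * f x + f y) ->
  (forall x, `|f x| <= C * `|x|) ->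
  exists v, forall u, f u = inner u v.
Proof.
move=> C0 fP fC.
pose F u := inner u u - (f u + (f u)^*).
have F_real u : F u \is Num.real.
  by rewrite CrealE /F !rmorphB !rmorphD/= conjCK -innerC [_^* + _]addrC.
have F_ge u : - C ^+ 2 <= F u.
  have fr : f u + (f u)^* \is Num.real.
    by rewrite CrealE rmorphD/= conjCK addrC.
  have f2 : f u + (f u)^* <= 2 * (C * `|u|).
    apply: le_trans (real_ler_norm fr) _; apply: le_trans (ler_normD _ _) _.
    by rewrite norm_conjC mulr_natl mulr2n lerD.
  rewrite -subr_ge0 opprK /F inner_norm.
  have : 0 <= (`|u| - C) ^+ 2.
    by rewrite real_exprn_even_ge0// rpredB// ?normr_real// ger0_real.
  move=> /le_trans; apply; rewrite -subr_ge0.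
  rewrite (_ : _ - _ = 2 * (C * `|u|) - (f u + (f u)^*)); last ring.
  by rewrite subr_ge0.
have [m [mF Fm]] := exists_approx_inf 0 F_real F_ge.
have f0 : f 0 = 0.
  have := fP 1 0 0; rewrite scaler0 addr0 mul1r => /eqP.
  by rewrite -subr_eq subrr => /eqP.
have fD x y : f (x + y) = f x + f y by rewrite -[x in LHS]scale1r fP mul1r.
have fZ a x : f (a *: x) = a * f x by rewrite -[_ *: _]addr0 fP f0 addr0.
have par u v : inner (u - v) (u - v) <= 2 * (F u - m) + 2 * (F v - m).
  have := mF (2^-1 *: (u + v)).
  rewrite {1}/F fZ fD innerBl !innerBr innerZl innerZr innerDl !innerDr.
  rewrite !rmorphM !rmorphD/= fmorphV/= conjC_nat.
  rewrite /F; set p := inner u u; set q := inner v v; set r := inner u v.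
  set s := inner v u; set x := f u; set y := f v => mle.
  rewrite -subr_ge0.
  rewrite [X in 0 <= X](_ : _ = 4 * (2^-1 * (2^-1 * (p + r + (s + q))) -
      (2^-1 * (x + y) + 2^-1 * (x^* + y^*)) - m)); last by field.
  by rewrite mulr_ge0// subr_ge0.
have pert u h (e : R[i]) : F u < m + e ->
    `|inner h u - f h| ^+ 2 <= e * (1 + inner h h).
  move=> Fu; set d := inner h u - f h; pose s := (1 + inner h h)^-1.
  have dE : d = inner h u - f h by [].
  clearbody d; have hh := inner_ge0 h.
  have h1 : 0 < 1 + inner h h by rewrite ltr_pwDl.
  have s0 : 0 < s by rewrite invr_gt0.
  have sE : s^* = s by rewrite conj_Creal// gtr0_real.
  have sh : s * inner h h = 1 - s.
    by apply: (@mulfI _ (1 + inner h h)); [rewrite gt_eqF|rewrite /s; field; rewrite gt_eqF].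
  have zE : (- (s * d^*))^* = - (s * d) by rewrite rmorphN rmorphM/= sE conjCK.
  (* Moving u by the multiple - s d^* of h lowers F by at least s |d|^2. *)
  have Fv : F (- (s * d^*) *: h + u) = F u - s * (d * d^*) * (1 + s).
    rewrite /F fP innerDl !innerDr !innerZl !innerZr (innerC u h).
    rewrite rmorphD/= rmorphM/= !zE.
    transitivity (inner u u - (f u + (f u)^*) - 2 * s * (d * d^*) +
                  s * (d * d^*) * (s * inner h h)).
      by rewrite dE !rmorphB/=; ring.
    by rewrite sh; ring.
  have dd : 0 <= d * d^* by rewrite mul_conjC_ge0.
  have sd : 0 <= s * (d * d^*) by rewrite mulr_ge0// ltW.
  have : s * (d * d^*) <= e.
    have := mF (- (s * d^*) *: h + u); rewrite Fv => mv.
    have : m <= F u - s * (d * d^*).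
      by apply: le_trans mv _; rewrite lerB// ler_peMr// lerDl ltW.
    rewrite lerBrDr addrC -lerBrDr => /le_trans; apply.
    by rewrite lerBlDl ltW.
  by rewrite /s ler_pdivrMl// normCK [e * _]mulrC.
have inv0 n : 0 < n.+1%:R^-1 :> R[i] by rewrite invr_gt0.
have [u uP] := choice (fun n : nat => Fm n.+1%:R^-1 (inv0 n)).
have invN (e : R[i]) (c : R[i]) : 0 < e -> 0 <= c -> exists N, forall n, (N <= n)%N ->
    n.+1%:R^-1 * c < e.
  move=> e0 c0; have c1 : 0 < c + 1 by rewrite ltr_wpDl.
  have [N Ne] := complex_lt_invSn (divr_gt0 e0 c1).
  exists N => n Nn; rewrite ltr_pdivlMr// in Ne.
  apply: le_lt_trans Ne; apply: ler_pM => //; last by rewrite lerDl.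
  by rewrite lef_pV2 ?posrE// ler_nat.
have sqr_lt (x e : R[i]) : 0 <= x -> 0 < e -> x ^+ 2 < e ^+ 2 -> x < e.
  by move=> x0 e0; rewrite ltr_pXn2r// nnegrE ltW.
(* By [par] almost minimizers are close to each other. *)
have uc : cvg (u @ \oo).
  apply: cauchy_cvg; apply: cauchy_exP => e e0.
  have [N Ne] := invN (e ^+ 2) 4 (exprn_gt0 _ e0) (ler0n _ _).
  exists (u N); exists N => // n /= Nn.
  rewrite -ball_normE /=; apply: sqr_lt => //; rewrite -inner_norm.
  apply: le_lt_trans (par _ _) _; apply: lt_trans (Ne N (leqnn _)).
  rewrite [ltRHS](_ : _ = 2 * N.+1%:R^-1 + 2 * N.+1%:R^-1); last ring.
  rewrite ltrD// ltr_pM2l// ltrBlDl//.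
  apply: lt_le_trans (uP n) _; rewrite lerD2l.
  by rewrite lef_pV2 ?posrE// ler_nat.
exists (lim (u @ \oo)) => h; rewrite innerC.
have ul := @inner_cvg _ _ eventually_filter u _ h uc.
apply: (can_inj (@conjCK R[i])); rewrite conjCK.
apply: (cvg_unique _ _ ul); first exact: norm_hausdorff.
apply/cvgrPdist_lt => e e0.
have hh : 0 <= 1 + inner h h by rewrite addr_ge0// inner_ge0.
have [N Ne] := invN (e ^+ 2) _ (exprn_gt0 _ e0) hh.
exists N => // n /= Nn; apply: sqr_lt => //.
rewrite -norm_conjC rmorphB/= conjCK -innerC distrC.
exact: le_lt_trans (pert _ _ _ (uP n)) (Ne n Nn).
Qed.

Definition is_adj (f g : H -> H) := forall u w, inner (f u) w = inner u (g w).

Lemma adj_unique f g : is_adj f g -> adj f = g.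
Proof.
move=> fg; apply/funext => w; rewrite /adj /adjoint; case: xgetP => [v _ [_ fv]|no].
  by apply: inner_eq => u; rewrite -fv// fg.
by case: (no (g w)); split => // u _; exact: fg.
Qed.

Lemma adjP (X : {linear H -> H}) : continuous X -> is_adj X (adj X).
Proof.
move=> cX u w; rewrite /adj /adjoint.
suff [v vP] : exists v, forall u, inner (X u) w = inner u v.
  case: xgetP => [v' _ [_ ->]//|no].
  by case: (no v); split => // u' _; exact: vP.
have /linear_boundedP/pinfty_ex_gt0[r r0 Xr] : bounded_near X (nbhs 0).
  exact/linear_bounded_continuous.
apply: (@riesz (fun u => inner (X u) w) (r * `|w|)).
- by rewrite mulr_ge0// ltW.
- by move=> a x y; rewrite linearP innerDl innerZl.
- move=> x; apply: le_trans (norm_inner_le _ _) _.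
  by rewrite mulrAC ler_wpM2r.
Qed.

End Riesz.

(** * Telescoping, adjoint pairs and tuples of words *)

Section Telescope.
Variables (V : zmodType) (I : Type) (P : I -> V -> V).
Hypotheses (PB : forall i x y, P i (x - y) = P i x - P i y)
  (PC : forall i j x, P i (P j x) = P j (P i x)).

Definition iter_sum i q (x : V) := \sum_(p < q) iter p (P i) x.

Lemma iter_additive i p x y : iter p (P i) (x - y) = iter p (P i) x - iter p (P i) y.
Proof. by elim: p => //= p ->. Qed.

Lemma iter_comm i j p x : iter p (P i) (P j x) = P j (iter p (P i) x).
Proof. by elim: p => //= p ->. Qed.

Lemma iter_sum_telescope i q x : x - iter q (P i) x = iter_sum i q (x - P i x).
Proof.
elim: q => [|q ih]; first by rewrite /iter_sum big_ord0 subrr.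
rewrite /iter_sum big_ord_recr/= -/(iter_sum i q _) -ih iter_additive iter_comm.
by rewrite addrA subrK.
Qed.

Lemma iter_sum_sub i j q x : iter_sum j q x - P i (iter_sum j q x) = iter_sum j q (x - P i x).
Proof.
have P0 : P i 0 = 0 by have := PB i 0 0; rewrite !subrr.
rewrite /iter_sum; elim: q => [|q ih]; first by rewrite !big_ord0 P0 subrr.
have PD a b : P i (a + b) = P i a + P i b.
  by rewrite -[b in LHS]opprK PB -[- b]sub0r PB P0 sub0r opprK.
by rewrite !big_ord_recr/= PD opprD addrACA ih iter_additive iter_comm.
Qed.

(** As 1 - P_i commutes with the partial sums of the powers of the other maps,
    the telescoping can be carried out one factor at a time. *)
Lemma foldr_telescope (q : I -> nat) (r : seq I) x :
  foldr (fun i y => y - iter (q i) (P i) y) x r =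
  foldr (fun i => iter_sum i (q i)) (foldr (fun i y => y - P i y) x r) r.
Proof.
elim: r => //= i r ->; rewrite iter_sum_telescope; congr (iter_sum _ _ _).
move: (foldr (fun i y => y - P i y) x r) => y.
by elim: r => //= j r ih; rewrite iter_sum_sub ih.
Qed.

End Telescope.

Lemma compose_allE (V : Type) (k : nat) (A : 'I_k -> V -> V) v :
  compose_all A v = foldr A v (index_enum 'I_k).
Proof.
rewrite /compose_all; elim: (index_enum _) => [|i s ih]; first by rewrite big_nil.
by rewrite big_cons /= ih.
Qed.

Section Adjoints.
Context {R : realType} {H : hilbertType R}.
Implicit Types f g : H -> H.

Lemma is_adjC f g u w : is_adj f g -> inner (g u) w = inner u (f w).
Proof. by move=> fg; rewrite innerC -fg -innerC. Qed.

Lemma is_adj_comp f g f' g' : is_adj f g -> is_adj f' g' -> is_adj (f \o f') (g' \o g).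
Proof. by move=> fg fg' u w /=; rewrite fg fg'. Qed.

Lemma is_adj_id : is_adj (idfun : H -> H) idfun.
Proof. by []. Qed.

Lemma is_adj_inj f g g' : is_adj f g -> is_adj f g' -> g =1 g'.
Proof. by move=> fg fg' w; apply: inner_eq => u; rewrite -fg fg'. Qed.

Lemma adj_comm f g f' g' : is_adj f g -> is_adj f' g' ->
  (forall h, f (f' h) = f' (f h)) -> forall h, g (g' h) = g' (g h).
Proof.
move=> fg fg' ff h; apply: inner_eq => u.
have -> : inner u (g (g' h)) = inner (f' (f u)) h by rewrite -fg -fg'.
by rewrite -ff fg fg'.
Qed.

Lemma is_adj_linear f g : is_adj f g -> linear g.
Proof.
move=> fg a x y; apply: inner_eq => u.
by rewrite -fg innerDr innerZr !fg -innerZr -innerDr.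
Qed.

End Adjoints.

Section Words.
Context {k : nat} {n : 'I_k -> nat}.
Implicit Types (b : words (n:=n)) (i : 'I_k).

Fixpoint words_eq i p : seq (seq 'I_(n i)) :=
  if p is p'.+1 then [seq j :: a | j <- enum 'I_(n i), a <- words_eq i p'] else [:: [::]].

Definition words_lt i q := flatten [seq words_eq i p | p <- iota 0 q].

Lemma mem_words_eq i p a : (a \in words_eq i p) = (size a == p).
Proof.
elim: p a => [|p ih] [|j a] //=.
  by apply/allpairsP => -[[j' a'] []].
apply/allpairsP/idP => /= [[[j' a'] /= [_ + [_ ->]]]|ap].
  by rewrite ih.
by exists (j, a); rewrite mem_enum ih.
Qed.

Lemma uniq_words_eq i p : uniq (words_eq i p).
Proof.
elim: p => //= p ih; apply: allpairs_uniq => //; first exact: enum_uniq.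
by move=> [j a] [j' a'] _ _ [-> ->].
Qed.

Lemma size_words_eq i p : size (words_eq i p) = (n i ^ p)%N.
Proof. by elim: p => //= p ih; rewrite size_allpairs ih size_enum_ord expnS. Qed.

Lemma mem_words_lt i q a : (a \in words_lt i q) = (size a < q)%N.
Proof.
apply/flattenP/idP => [[_ /mapP[p + ->]]|aq].
  by rewrite mem_iota mem_words_eq => /= pq /eqP ->.
by exists (words_eq i (size a)); rewrite ?mem_words_eq// map_f// mem_iota.
Qed.

Lemma words_ltS i q : words_lt i q.+1 = words_lt i q ++ words_eq i q.
Proof. by rewrite /words_lt -addn1 iotaD map_cat flatten_cat/= cats0. Qed.

Lemma uniq_words_lt i q : uniq (words_lt i q).
Proof.
elim: q => // q ih; rewrite words_ltS cat_uniq ih uniq_words_eq andbT/=.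
apply/hasPn => a; rewrite mem_words_eq => /eqP <-.
by apply/negP; rewrite mem_words_lt ltnn.
Qed.

Lemma size_words_lt i q : size (words_lt i q) = (\sum_(0 <= p < q) n i ^ p)%N.
Proof.
elim: q => [|q ih]; first by rewrite big_geq.
by rewrite words_ltS size_cat ih size_words_eq big_nat_recr.
Qed.

Definition word_nil : words (n:=n) := [ffun i => [::]].

Definition word_set b i (a : seq 'I_(n i)) : words (n:=n) :=
  [ffun j => @eqtype.dfwith _ (fun j => seq 'I_(n j)) (fun j => b j) i a j].

Lemma word_set_same b i (a : seq 'I_(n i)) : word_set b a i = a.
Proof. by rewrite ffunE eqtype.dfwith_in. Qed.

Lemma word_set_neq b i j (a : seq 'I_(n i)) : i != j -> word_set b a j = b j.
Proof. by move=> ij; rewrite ffunE eqtype.dfwith_out. Qed.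

(** Components outside r stay empty, so that the enumeration can be built and
    reasoned about one factor at a time. *)
Definition words_prod (L : forall i, seq (seq 'I_(n i))) (r : seq 'I_k) : seq (words (n:=n)) :=
  foldr (fun i s => [seq word_set b a | a <- L i, b <- s]) [:: word_nil] r.

Variable L : forall i, seq (seq 'I_(n i)).

Lemma mem_words_prod r b : uniq r ->
  (b \in words_prod L r) = [forall i, if i \in r then b i \in L i else b i == [::]].
Proof.
elim: r b => [|i r ih] b /=.
  move=> _; rewrite inE; apply/eqP/forallP => [-> i|b0]; first by rewrite ffunE.
  by apply/ffunP => i; rewrite [RHS]ffunE; apply/eqP; exact: b0.
move=> /andP[ir ur]; apply/allpairsP/forallP => [[[a b'] /= [aL + ->]] j|bL].
  rewrite ih// => /forallP/(_ j); rewrite inE [j == i]eq_sym.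
  case: (eqVneq i j) => [<-|ij]; first by rewrite word_set_same.
  by rewrite word_set_neq.
exists (b i, word_set b ([::] : seq 'I_(n i))); split => /=.
- by have := bL i; rewrite inE eqxx.
- rewrite ih//; apply/forallP => j; have := bL j; rewrite inE [j == i]eq_sym.
  case: (eqVneq i j) => [<-|ij] /=; first by rewrite (negbTE ir) word_set_same.
  by rewrite word_set_neq.
- apply/ffunP => j; have [<-|ij] := eqVneq i j; first by rewrite word_set_same.
  by rewrite !word_set_neq.
Qed.

Lemma uniq_words_prod r : uniq r -> (forall i, uniq (L i)) -> uniq (words_prod L r).
Proof.
move=> + uL; elim: r => //= i r ih /andP[ir ur].
apply: allpairs_uniq => //; first exact: ih.
move=> _ _ /allpairsP[[a b] [_ + ->]] /allpairsP[[a' b'] [_ + ->]] /=.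
rewrite !mem_words_prod// => /forallP bL /forallP bL' bb'.
have aa' : a = a' by rewrite -(word_set_same b a) bb' word_set_same.
rewrite -aa'; congr (_, _); apply/ffunP => j.
have [<-|ij] := eqVneq i j.
  by have := bL i; have := bL' i; rewrite (negbTE ir) => /eqP -> /eqP ->.
by rewrite -(word_set_neq b a ij) bb' word_set_neq.
Qed.

Lemma size_words_prod r : size (words_prod L r) = (\prod_(i <- r) size (L i))%N.
Proof.
by elim: r => [|i r ih]; rewrite ?big_nil//= size_allpairs ih big_cons.
Qed.

End Words.

(** * Truncated defects and the frame inequalities *)

Section Operators.
Context {R : realType} {H : hilbertType R} {k : nat} {n : 'I_k -> nat}.
Variable X : op_tuple H n.
Hypothesis cX : forall i (j : 'I_(n i)), continuous (X j).
Hypothesis comX : forall s t (i : 'I_(n s)) (j : 'I_(n t)) h, s != t ->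
  X i (X j h) = X j (X i h).
Implicit Types (Y Z : H -> H) (i : 'I_k) (b : words (n:=n)) (h : H).

Lemma adjX i (j : 'I_(n i)) : is_adj (X j) (adj (X j)).
Proof. exact: adjP. Qed.

Lemma word_op_linear i (a : seq 'I_(n i)) : linear (word_op X a).
Proof. by elim: a => //= j a ih c x y /=; rewrite ih linearP. Qed.

HB.instance Definition _ i (a : seq 'I_(n i)) :=
  GRing.isLinear.Build R[i] H H *:%R (word_op X a) (word_op_linear a).

Lemma word_adj i (a : seq 'I_(n i)) : is_adj (word_op X a) (adj (word_op X a)).
Proof.
suff [g ag] : exists g, is_adj (word_op X a) g by rewrite (adj_unique ag).
elim: a => [|j a [g ag]]; first by exists idfun.
by exists (g \o adj (X j)); apply: is_adj_comp => //; exact: adjX.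
Qed.

Lemma word_adj_cons i j (a : seq 'I_(n i)) h :
  adj (word_op X (j :: a)) h = adj (word_op X a) (adj (X j) h).
Proof.
have E := is_adj_comp (adjX j) (word_adj a).
exact: (is_adj_inj (word_adj (j :: a)) E).
Qed.

Lemma PhiB i Y Z : Phi X i (Y - Z) = Phi X i Y - Phi X i Z.
Proof.
apply/funext => h; transitivity (Phi X i Y h - Phi X i Z h) => //.
rewrite /Phi -sumrB; apply: eq_bigr => j _.
exact: linearB.
Qed.

Lemma Phi_comm s t Y : Phi X s (Phi X t Y) = Phi X t (Phi X s Y).
Proof.
have [<-//|st] := eqVneq s t.
apply/funext => h; rewrite /Phi.
under eq_bigr do rewrite linear_sum; rewrite exchange_big.
apply: eq_bigr => i _; rewrite linear_sum; apply: eq_bigr => j _.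
rewrite comX//; congr (X _ (X _ (Y _))).
by apply: (adj_comm (adjX i) (adjX j)) => h'; rewrite comX// eq_sym.
Qed.

Lemma Phi_pos i Y : positive_op Y -> positive_op (Phi X i Y).
Proof.
move=> Y0 h; rewrite /Phi inner_suml; apply: sumr_ge0 => j _.
by rewrite (adjX j (Y _) h).
Qed.

Lemma iter_Phi_pos i p Y : positive_op Y -> positive_op (iter p (Phi X i) Y).
Proof. by move=> Y0; elim: p => //= p ih; exact: Phi_pos. Qed.

(** Powers of Phi and their partial sums are the cases where La lists all words
    of a given length, respectively all words below some length. *)
Definition sandwich i (La : seq (seq 'I_(n i))) Y : H -> H :=
  fun h => \sum_(a <- La) word_op X a (Y (adj (word_op X a) h)).

Lemma iter_Phi_sandwich i p Y : iter p (Phi X i) Y = sandwich (words_eq i p) Y.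
Proof.
elim: p => [|p ih] /=; apply/funext => h.
  by rewrite /sandwich big_seq1 /= (adj_unique (@is_adj_id _ _)).
rewrite ih /Phi /sandwich big_allpairs_dep/= big_enum/=; apply: eq_bigr => j _.
by rewrite linear_sum; apply: eq_bigr => a _; rewrite word_adj_cons.
Qed.

Lemma iter_sum_sandwich i q Y : iter_sum (Phi X) i q Y = sandwich (words_lt (n:=n) i q) Y.
Proof.
apply/funext => h; rewrite /iter_sum fct_sumE; elim: q => [|q ih].
  by rewrite big_ord0 /sandwich big_nil.
by rewrite big_ord_recr/= ih words_ltS /sandwich big_cat/= iter_Phi_sandwich.
Qed.

Definition word_ops (r : seq 'I_k) b h := foldr (fun i x => word_op X (b i) x) h r.

(** The adjoint of a product is the product of the adjoints in reverse order,
    whence a left fold. *)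
Definition word_adjs (r : seq 'I_k) b h := foldl (fun x i => adj (word_op X (b i)) x) h r.

Lemma word_adjsP r b : is_adj (word_ops r b) (word_adjs r b).
Proof.
by elim: r => //= i r ih u w; rewrite /word_ops/= (word_adj (b i)) -/(word_ops r b u) ih.
Qed.

Lemma word_ops_linear r b : linear (word_ops r b).
Proof. by elim: r => //= i r ih c x y; rewrite /word_ops /= -!/(word_ops _ _ _) ih linearP. Qed.

HB.instance Definition _ r b :=
  GRing.isLinear.Build R[i] H H *:%R (word_ops r b) (word_ops_linear r b).

Lemma word_ops_word_set r b i (a : seq 'I_(n i)) h : i \notin r ->
  word_ops r (word_set b a) h = word_ops r b h.
Proof.
elim: r => //= j r ih; rewrite inE negb_or => /andP[ij ir].
by rewrite /word_ops/= -!/(word_ops _ _ _) ih// word_set_neq.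
Qed.

Lemma word_adjs_word_set r b i (a : seq 'I_(n i)) h : i \notin r ->
  word_adjs r (word_set b a) h = word_adjs r b h.
Proof.
move=> ir; have E := word_adjsP r (word_set b a).
by apply: (is_adj_inj E) => u w; rewrite word_ops_word_set//; exact: word_adjsP.
Qed.

Lemma foldr_sandwich (L : forall i, seq (seq 'I_(n i))) r Y h : uniq r ->
  foldr (fun i => sandwich (L i)) Y r h =
  \sum_(b <- words_prod L r) word_ops r b (Y (word_adjs r b h)).
Proof.
elim: r h => [|i r ih] h /=; first by rewrite big_seq1.
move=> /andP[ir ur]; rewrite /sandwich big_allpairs_dep/=; apply: eq_bigr => a _.
rewrite ih// linear_sum; apply: eq_bigr => b _.
rewrite word_set_same.
by rewrite word_ops_word_set// word_adjs_word_set.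
Qed.

(** In the composite defining Delta the maps of the other factors are
    identities; they form an initial segment, which can be dropped. *)
Lemma Delta_suffix (pre r : seq 'I_k) Y : index_enum 'I_k = pre ++ r ->
  Delta X (fun i => i \in r) Y = foldr (fun i Z => Z - Phi X i Z) Y r.
Proof.
move=> Er; rewrite /Delta compose_allE Er foldr_cat.
have : uniq (pre ++ r) by rewrite -Er index_enum_uniq.
rewrite cat_uniq => /and3P[_ /hasPn pr _].
set A := fun i : 'I_k => _.
have -> : forall Z, foldr A Z pre = Z.
  move=> Z; rewrite {}/A; elim: pre pr {Er} => //= i s ih pr.
  rewrite ih; last by move=> j jr; have := pr j jr; rewrite inE negb_or => /andP[].
  by case: (boolP (i \in r)) => // /pr; rewrite inE eqxx.
have : {subset r <= r} by [].
move: {1 3 4}r => s; elim: s => //= i s ih sr.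
rewrite ih; last by move=> j js; apply: sr; rewrite inE js orbT.
by rewrite /A (sr i) ?mem_head.
Qed.

Hypothesis posX : forall p, positive_op (Delta X p idfun).

(** The polyball inequalities enter twice: every partial defect is positive,
    and so is its image under the positive maps given by the partial sums of
    powers; in particular each factor can only decrease the truncation. *)
Lemma truncated_defect (q : 'I_k -> nat) (pre r : seq 'I_k) h :
  index_enum 'I_k = pre ++ r ->
  let Y := foldr (fun i Z => Z - iter (q i) (Phi X i) Z) idfun r in
  [/\ 0 <= inner (Y h) h, inner (Y h) h <= inner h h &
      inner h h - \sum_(i <- r) inner (iter (q i) (Phi X i) idfun h) h
        <= inner (Y h) h].
Proof.
elim: r pre h => [|i r ih] pre h Er Y.
  by rewrite big_nil subr0; split => //; exact: inner_ge0.
have Y_pos : positive_op Y.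
  rewrite /Y (foldr_telescope PhiB Phi_comm) -(Delta_suffix _ Er).
  have : positive_op (Delta X (fun i0 => i0 \in i :: r) idfun) by exact: posX.
  move: (Delta _ _ _) => Z Z0; elim: (i :: r) => //= j s ihs g.
  rewrite iter_sum_sandwich /sandwich inner_suml; apply: sumr_ge0 => a _.
  by rewrite word_adj.
have Er' : index_enum 'I_k = rcons pre i ++ r by rewrite cat_rcons.
pose Y' := foldr (fun i Z => Z - iter (q i) (Phi X i) Z) idfun r.
have YE : inner (Y h) h = inner (Y' h) h - inner (iter (q i) (Phi X i) Y' h) h.
  by rewrite -innerBl.
have Y'_pos : positive_op Y' by move=> g; have [] := ih _ g Er'.
have Y'_le : positive_op (idfun - Y').
  by move=> g; rewrite innerBl subr_ge0; have [] := ih _ g Er'.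
have [_ le1 le2] := ih _ h Er'.
split; first exact: Y_pos.
- rewrite YE (le_trans _ le1)// lerBlDr lerDl; exact: iter_Phi_pos.
- rewrite big_cons YE opprD addrCA addrC lerB//.
  rewrite -subr_ge0 -innerBl.
  have := @iter_Phi_pos i (q i) _ Y'_le h.
  by rewrite (iter_additive PhiB).
Qed.

(** Strict bounds on the lengths, to match the geometric sums of the
    telescoping identity. *)
Definition box (q : 'I_k -> nat) : seq (words (n:=n)) :=
  words_prod (fun i => words_lt i (q i)) (index_enum 'I_k).

Definition Tword b := word_ops (index_enum 'I_k) b.

Variable w : H.
Hypothesis defectE : forall h, defect X h = inner h w *: w.

(** By telescoping, the truncated defect is the sum of the T_b D T_b^* over the
    box, where D is the defect; its quadratic form is a sum of squares because
    D has rank one. *)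
Lemma truncated_frame (q : 'I_k -> nat) h :
  inner (foldr (fun i Z => Z - iter (q i) (Phi X i) Z) idfun (index_enum 'I_k) h) h
  = \sum_(b <- box q) `|inner h (Tword b w)| ^+ 2.
Proof.
rewrite (foldr_telescope PhiB Phi_comm) -(@Delta_suffix [::])//.
have -> : Delta X (fun i => i \in index_enum 'I_k) idfun = defect X.
  by rewrite /defect; congr Delta; apply/funext => i; rewrite mem_index_enum.
have -> : (fun i => iter_sum (Phi X) i (q i)) = (fun i => sandwich (words_lt i (q i))).
  by apply/funext => i; apply/funext => Y; rewrite iter_sum_sandwich.
rewrite foldr_sandwich ?index_enum_uniq// inner_suml; apply: eq_bigr => b _.
rewrite defectE word_adjsP innerZl.
have E : inner (word_adjs (index_enum 'I_k) b h) w = inner h (Tword b w).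
  exact: is_adjC (word_adjsP _ b).
by rewrite [inner w _]innerC E normCK.
Qed.

Lemma frame_upper q h : \sum_(b <- box q) `|inner h (Tword b w)| ^+ 2 <= inner h h.
Proof. by rewrite -truncated_frame; have [] := @truncated_defect q [::] _ h erefl. Qed.

Lemma frame_lower q h :
  inner h h - \sum_(i < k) inner (iter (q i) (Phi X i) idfun h) h <=
  \sum_(b <- box q) `|inner h (Tword b w)| ^+ 2.
Proof. by rewrite -truncated_frame; have [] := @truncated_defect q [::] _ h erefl. Qed.

End Operators.

(** * Rank one defects and the traces of the curvature *)

Section PositiveOperators.
Context {R : realType} {H : hilbertType R}.

(** Over the complex numbers a positive operator is self-adjoint: polarize with
    the coefficients 1 and i. *)
Lemma positive_is_adj (A : H -> H) : linear A -> positive_op A -> is_adj A A.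
Proof.
move=> lA A0 x y.
have AD u v : A (u + v) = A u + A v by rewrite -[u in LHS]scale1r lA scale1r.
have A00 : A 0 = 0 by have := AD 0 0; rewrite addr0 => /eqP; rewrite -subr_eq subrr => /eqP.
have AZ c u : A (c *: u) = c *: A u by rewrite -[c *: u in LHS]addr0 lA A00 addr0.
have real u : (inner (A u) u)^* = inner (A u) u by rewrite conj_Creal// ger0_real.
have := real (x + y); rewrite AD !innerDl !innerDr !rmorphD/= !real.
have := real (x + 'i *: y); rewrite AD AZ !innerDl !innerDr !innerZl !innerZr.
rewrite !rmorphD !rmorphM !conjCi/= rmorphN/= conjCi opprK !real.
rewrite (innerC x (A y)).
set a := inner (A x) y; set b := inner (A y) x.
set p := inner (A x) x; set q := inner (A y) y => h1 h2.
have i0 : 'i != 0 :> R[i] by exact: neq0Ci.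
have {}h1 : a^* - b^* = b - a.
  apply: (mulfI i0); apply: (@addrI _ (p + ('i * (- 'i * q)))).
  have : p + 'i * (- 'i * q) + 'i * (a^* - b^*) =
         p + 'i * a^* + (- 'i * b^* + - 'i * ('i * q)) by ring.
  by move=> ->; rewrite h1; ring.
have {}h2 : a^* + b^* = a + b.
  apply: (@addrI _ (p + q)).
  transitivity (p + a^* + (b^* + q)); first ring.
  by rewrite h2; ring.
apply: (@mulfI _ 2); first by rewrite pnatr_eq0.
transitivity ((a + b) - (b - a)); first ring.
by rewrite -h1 -h2; ring.
Qed.

(** A self-adjoint operator with range spanned by v is a real multiple of
    <., v> v; positivity of the multiple lets it be absorbed in the vector. *)
Lemma rank_one_form (A : H -> H) : linear A -> positive_op A ->
  has_dim (range A) 1 -> exists2 w, w != 0 & forall h, A h = inner h w *: w.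
Proof.
move=> lA A0 [b [bfree bA]].
have AA := positive_is_adj lA A0.
pose v := b ord0.
have v0 : v != 0.
  apply/eqP => v0; have := bfree (fun=> 1) _ ord0.
  by rewrite big_ord1 scale1r -/v v0 => /(_ erefl)/eqP; rewrite oner_eq0.
have Av h : exists c, A h = c *: v.
  have : lin_span (range b) (A h) by rewrite bA; exists h.
  move: (A h) => y; move: y; apply: lin_span_ind => [|a x y [i _ <-] [c ->]].
    by exists 0; rewrite scale0r.
  by exists (a + c); rewrite scalerDl (ord1 i).
have vv := inner_gt0 v0; have vv0 : inner v v != 0 by rewrite gt_eqF.
have [m Amv] := Av v.
have m0 : 0 <= m.
  by have := A0 v; rewrite Amv innerZl pmulr_lge0.
have AE h : A h = (m / inner v v * inner h v) *: v.
  have [c Ac] := Av h; rewrite Ac; congr (_ *: _).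
  have := AA h v; rewrite Ac Amv innerZl innerZr conj_Creal ?ger0_real// => E.
  by apply: (mulIf vv0); rewrite E; field.
have mn0 : m != 0.
  have [h _ hv] : range A v.
    rewrite -bA; apply: lin_span_sub; by exists ord0.
  by apply: contra v0 => /eqP m00; rewrite -hv AE m00 !mul0r scale0r.
pose r := sqrtC (m / inner v v).
have rr : r * r^* = m / inner v v.
  by rewrite -normCK ger0_norm ?sqrtC_ge0 ?divr_ge0 ?inner_ge0// sqrtCK.
exists (r *: v).
  by rewrite scaler_eq0 negb_or v0 andbT sqrtC_eq0 mulf_neq0// invr_eq0.
by move=> h; rewrite AE scalerA innerZr -rr; congr (_ *: _); ring.
Qed.

(** A positive square root S is self-adjoint, so <S x, S y> = <S (S x), y> does
    not depend on its choice; that there is one is seen by rescaling A. *)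
Lemma sqrt_opP (A : H -> H) (w : H) : w != 0 -> (forall h, A h = inner h w *: w) ->
  forall x y, inner (sqrt_op A x) (sqrt_op A y) = inner x w * (inner y w)^*.
Proof.
move=> w0 AE x y; rewrite /sqrt_op.
case: xgetP => [S _ [[lS _] S0 SS]|no].
  by rewrite (positive_is_adj lS S0) SS AE innerZr mulrC.
have n0 : `|w| != 0 by rewrite normr_eq0.
pose u := `|w|^-1 *: w.
have uw : inner u w = `|w| by rewrite innerZl inner_norm expr2 mulKf.
case: (no (fun h => inner h w *: u)); split.
- split.
    by move=> a h h'; rewrite innerDl innerZl scalerDl -scalerA.
  by move=> h; apply: cvgZ; [exact: inner_cvg|exact: cvg_cst].
- move=> h; rewrite /u scalerA innerZl [inner w h]innerC mulrAC -normCK.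
  by rewrite mulr_ge0 ?exprn_ge0// invr_ge0.
- by move=> h; rewrite innerZl uw /u scalerA AE mulfK.
Qed.

End PositiveOperators.

Section RankOne.
Context {R : realType} {H : hilbertType R} {k : nat} {n : 'I_k -> nat}.
Variable X : op_tuple H n.
Hypothesis cX : forall i (j : 'I_(n i)), continuous (X j).
Hypothesis comX : forall s t (i : 'I_(n s)) (j : 'I_(n t)) h, s != t ->
  X i (X j h) = X j (X i h).
Hypothesis posX : forall p, positive_op (Delta X p idfun).
Implicit Types (Y Z : H -> H) (i : 'I_k) (b c : words (n:=n)) (h : H).

Lemma Phi_linear i Y : linear Y -> linear (Phi X i Y).
Proof.
move=> lY a x y; rewrite /Phi scaler_sumr -big_split/=; apply: eq_bigr => j _.
by rewrite (is_adj_linear (adjX cX j)) lY linearP.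
Qed.

Lemma defectE : defect X = foldr (fun i Z => Z - Phi X i Z) idfun (index_enum 'I_k).
Proof.
rewrite -(@Delta_suffix _ _ _ _ _ [::])// /defect; congr Delta.
by apply/funext => i; rewrite mem_index_enum.
Qed.

Lemma subPhi_linear i Y : linear Y -> linear (Y - Phi X i Y).
Proof.
move=> lY a x y.
change (Y (a *: x + y) - Phi X i Y (a *: x + y) =
  a *: (Y x - Phi X i Y x) + (Y y - Phi X i Y y)).
by rewrite lY (Phi_linear i lY) scalerBr opprD addrACA.
Qed.

Lemma defect_linear : linear (defect X).
Proof.
rewrite defectE; elim: (index_enum _) => [//|i r ih]; exact: subPhi_linear.
Qed.

Lemma word_op_comm s t (a : seq 'I_(n s)) (c : seq 'I_(n t)) h : s != t ->
  word_op X a (word_op X c h) = word_op X c (word_op X a h).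
Proof.
move=> st.
have E (j : 'I_(n s)) x : X j (word_op X c x) = word_op X c (X j x) :> H.
  elim: c => //= l c ih; rewrite -ih; exact: comX.
by elim: a => //= j a ->; rewrite E.
Qed.

Lemma word_adj_comm s t (a : seq 'I_(n s)) (c : seq 'I_(n t)) h : s != t ->
  adj (word_op X a) (adj (word_op X c) h) = adj (word_op X c) (adj (word_op X a) h).
Proof.
move=> st; apply: (adj_comm (word_adj cX a) (word_adj cX c)) => h'.
exact: word_op_comm.
Qed.

Lemma word_adjsE r b h : uniq r ->
  foldr (fun i x => adj (word_op X (b i)) x) h r = word_adjs X r b h.
Proof.
elim: r h => //= i r ih h /andP[ir ur].
rewrite /word_adjs/= -/(word_adjs _ _ _ _) -ih//.
elim: r ir {ih ur} => //= j r ih; rewrite inE negb_or => /andP[ij ir].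
by rewrite word_adj_comm// ih.
Qed.

Lemma word_ops_cons_letter r b i (j : 'I_(n i)) h : uniq r -> i \in r ->
  word_ops X r (word_set b (j :: b i)) h = X j (word_ops X r b h).
Proof.
elim: r => //= t r ih /andP[tr ur]; rewrite inE.
case: (eqVneq i t) tr => [<- tr _|it tr /= ir].
  by rewrite word_set_same word_ops_word_set.
rewrite word_set_neq// ih//; apply: (@word_op_comm t i (b t) [:: j]).
by rewrite eq_sym.
Qed.

Definition words_of_degree (q : 'I_k -> nat) : seq (words (n:=n)) :=
  words_prod (fun i => words_eq i (q i)) (index_enum 'I_k).

Lemma mem_words_of_degree q b : (b \in words_of_degree q) = [forall i, size (b i) == q i].
Proof.
rewrite mem_words_prod ?index_enum_uniq//; apply: eq_forallb => i.
by rewrite mem_index_enum mem_words_eq.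
Qed.

Lemma uniq_words_of_degree q : uniq (words_of_degree q).
Proof. by apply: uniq_words_prod; [exact: index_enum_uniq|move=> i; exact: uniq_words_eq]. Qed.

Lemma size_words_of_degree q : size (words_of_degree q) = (\prod_i n i ^ q i)%N.
Proof. by rewrite size_words_prod; apply: eq_bigr => i _; rewrite size_words_eq. Qed.

Lemma mem_box q b : (b \in box q) = [forall i, (size (b i) < q i)%N].
Proof.
rewrite mem_words_prod ?index_enum_uniq//; apply: eq_forallb => i.
by rewrite mem_index_enum mem_words_lt.
Qed.

Lemma uniq_box q : uniq (box (n:=n) q).
Proof. by apply: uniq_words_prod; [exact: index_enum_uniq|move=> i; exact: uniq_words_lt]. Qed.

Lemma size_box q : size (box (n:=n) q) = (\prod_i \sum_(0 <= p < q i) n i ^ p)%N.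
Proof. by rewrite size_words_prod; apply: eq_bigr => i _; rewrite size_words_lt. Qed.

Lemma Phi_le1 i h : inner (Phi X i idfun h) h <= inner h h.
Proof.
have := posX (fun j => j == i) h; rewrite /Delta compose_allE.
have -> : foldr (fun j => iter (j == i) (fun Z => Z - Phi X j Z)) idfun (index_enum 'I_k)
    = (idfun : H -> H) - Phi X i idfun.
  have : i \in index_enum 'I_k by exact: mem_index_enum.
  have := index_enum_uniq 'I_k.
  elim: (index_enum _) => //= j r ih /andP[jr ur]; rewrite inE eq_sym.
  case: (eqVneq j i) jr => [-> jr _|ji jr /= ir]; last exact: ih.
  suff -> : foldr (fun j => iter (j == i) (fun Z => Z - Phi X j Z)) idfun r =
      (idfun : H -> H) by [].
  elim: r jr {ih ur} => //= t r ih; rewrite inE negb_or => /andP[it /ih ->].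
  by rewrite [t == i]eq_sym (negbTE it).
by rewrite innerBl subr_ge0.
Qed.

(** The inequality Phi_i(I) <= I makes the adjoints of the letters contractions,
    and by Cauchy-Schwarz the letters as well. *)
Lemma letter_contraction i (j : 'I_(n i)) h : inner (X j h) (X j h) <= inner h h.
Proof.
have adjle g : inner (adj (X j) g) (adj (X j) g) <= inner g g.
  apply: le_trans (Phi_le1 i g); rewrite /Phi inner_suml (bigD1 j)//=.
  rewrite (adjX cX j (adj (X j) g) g) lerDl; apply: sumr_ge0 => l _.
  by rewrite (adjX cX l (adj (X l) g) g) inner_ge0.
have : inner (X j h) (X j h) ^+ 2 <= inner h h * inner (X j h) (X j h).
  rewrite {1}(adjX cX j h (X j h)).
  have := cauchy_schwarz h (adj (X j) (X j h)).
  rewrite -(adjX cX j h (X j h)) ger0_norm ?inner_ge0// => /le_trans; apply.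
  by rewrite ler_wpM2l ?inner_ge0.
have [->|Xh0] := eqVneq (inner (X j h) (X j h)) 0; first by rewrite inner_ge0.
by rewrite expr2 ler_pM2r// lt_def Xh0 inner_ge0.
Qed.

Variable w : H.
Hypothesis w0 : w != 0.
Hypothesis defect_w : forall h, defect X h = inner h w *: w.

(** The trace of the sum of the operators <., T_b w> T_b w over the words of
    degree q. *)
Definition degree_mass (q : 'I_k -> nat) : R[i] :=
  \sum_(b <- words_of_degree q) inner (Tword X b w) (Tword X b w).

Lemma degree_mass_ge0 q : 0 <= degree_mass q.
Proof. by apply: sumr_ge0 => b _; exact: inner_ge0. Qed.

(** The words of degree q + e_i are those of degree q with one of the n_i
    letters put in front of the i-th component, and letters are contractions. *)
Lemma degree_mass_le q i : degree_mass (fun j => q j + (j == i))%N <= (n i)%:R * degree_mass q.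
Proof.
have -> : degree_mass (fun j => q j + (j == i))%N =
    \sum_(j <- enum 'I_(n i))
      \sum_(b <- words_of_degree q) inner (X j (Tword X b w)) (X j (Tword X b w)).
  rewrite /degree_mass.
  transitivity (\sum_(b <- [seq word_set b (j :: b i) | j <- enum 'I_(n i),
                                   b <- words_of_degree q])
      inner (Tword X b w) (Tword X b w)).
    apply: perm_big; apply: uniq_perm; first exact: uniq_words_of_degree.
      apply: allpairs_uniq; [exact: enum_uniq|exact: uniq_words_of_degree|].
      move=> [j b] [j' b'] _ _ /= bb'.
      have : j :: b i = j' :: b' i.
        by rewrite -(word_set_same b (j :: b i)) bb' word_set_same.
      move=> [<- bi]; congr (_, _); apply/ffunP => l.
      have [<-//|il] := eqVneq i l.
      by rewrite -(word_set_neq b (j :: b i) il) bb' word_set_neq.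
    move=> b; rewrite mem_words_of_degree; apply/forallP/allpairsP => [bq|[[j c]]] /=.
      have := bq i; rewrite eqxx addn1; case E: (b i) => [//|j a] /= ai.
      exists (j, word_set b a); split => /=; first by rewrite mem_enum.
        rewrite mem_words_of_degree; apply/forallP => l; have := bq l.
        have [<-|il] := eqVneq i l; first by rewrite word_set_same.
        by rewrite word_set_neq// addn0.
      rewrite word_set_same -E; apply/ffunP => l.
      have [<-|il] := eqVneq i l; first by rewrite word_set_same.
      by rewrite !word_set_neq.
    rewrite mem_words_of_degree => -[_ /forallP cq ->] l.
    have [<-|il] := eqVneq i l; first by rewrite word_set_same /= addn1 (eqP (cq i)).
    by rewrite word_set_neq// addn0 cq.
  rewrite big_allpairs_dep; apply: eq_bigr => j _; apply: eq_bigr => b _.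
  by rewrite /Tword word_ops_cons_letter ?index_enum_uniq ?mem_index_enum.
rewrite exchange_big /degree_mass mulr_sumr/=; apply: ler_sum => b _.
rewrite mulr_natl -[leRHS](_ : \sum_(j <- enum 'I_(n i)) inner (Tword X b w) (Tword X b w) = _).
  by apply: ler_sum => j _; exact: letter_contraction.
by rewrite big_const_seq count_predT size_enum_ord iter_addr addr0.
Qed.

Lemma berezin_op q h :
  adjoint inner setT (@ell2_dot _ H inner words) (berezin X)
    (@fock_proj R k n H q (berezin X h)) =
  \sum_(b <- words_of_degree q) inner h (Tword X b w) *: Tword X b w.
Proof.
have key u : ell2_dot inner (berezin X u) (@fock_proj R k n H q (berezin X h)) =
    inner u (\sum_(b <- words_of_degree q) inner h (Tword X b w) *: Tword X b w).
  have fs b : b \notin words_of_degree q ->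
      inner (berezin X u b) (@fock_proj R k n H q (berezin X h) b) = 0.
    by rewrite mem_words_of_degree /fock_proj => /negbTE ->; rewrite linear0r.
  transitivity (\sum_(b <- words_of_degree q)
      inner (berezin X u b) (@fock_proj R k n H q (berezin X h) b) : R[i]).
    exact: psum_lim (psum_finsupp (uniq_words_of_degree q) fs).
  rewrite inner_sumr big_seq [RHS]big_seq; apply: eq_bigr => b bq.
  rewrite /fock_proj -mem_words_of_degree bq /berezin (sqrt_opP w0 defect_w).
  rewrite !compose_allE !word_adjsE ?index_enum_uniq// innerZr.
  have E g : inner (word_adjs X (index_enum 'I_k) b g) w = inner g (Tword X b w).
    exact: is_adjC (word_adjsP cX _ b).
  by rewrite !E mulrC.
rewrite /adjoint; case: xgetP => [v _ [_ fv]|no].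
  by apply: inner_eq => u; rewrite -fv// key.
by case: (no (\sum_(b <- words_of_degree q) inner h (Tword X b w) *: Tword X b w)); split.
Qed.

Lemma berezin_traceE q : (exists E, orthonormal_basis inner [set: H] E) ->
  berezin_trace X q = degree_mass q.
Proof.
move=> onb; rewrite /berezin_trace.
rewrite (trace_frame (@inner_inner_on R H) (s := words_of_degree q)
  (f := fun b => Tword X b w))// => e _ /=.
rewrite berezin_op inner_suml; apply: eq_bigr => b _.
by rewrite innerZl [inner e _]innerC normCKC.
Qed.

End RankOne.

(** * Gauge covariance, orthogonality and the Parseval identity *)

Section Gauge.
Context {R : realType} {H : hilbertType R} {k : nat} {n : 'I_k -> nat}.
Variable X : op_tuple H n.
Hypothesis cX : forall i (j : 'I_(n i)), continuous (X j).
Variables (U : {linear H -> H}) (l : 'I_k -> R[i]).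
Hypothesis Uunitary : unitary_op U.
Hypothesis Ugauge : forall i (j : 'I_(n i)) h, U (X j (adj U h)) = l i *: X j h.
Hypothesis l1 : forall i, l i * (l i)^* = 1.
Implicit Types (Y : H -> H) (i : 'I_k) (b c : words (n:=n)) (h : H).

Lemma unitary_inner g h : inner (U g) (U h) = inner g h.
Proof. by case: Uunitary. Qed.

Lemma unitary_adjK h : adj U (U h) = h.
Proof.
have [_ Us] := Uunitary.
have /choice[V UV] y : exists x, U x = y.
  have [x _ <-] : range U y by rewrite Us.
  by exists x.
have UaV : is_adj U V by move=> u w; rewrite -{1}[w]UV unitary_inner.
rewrite (adj_unique UaV); apply: inner_eq => u.
by rewrite -unitary_inner UV unitary_inner.
Qed.

Lemma gauge_letter i (j : 'I_(n i)) h : U (X j h) = l i *: X j (U h).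
Proof. by rewrite -Ugauge unitary_adjK. Qed.

(** Adjoints scale by the conjugate of l i, so l i cancels in X_j Y X_j^* and
    Phi, hence the defect, commutes with U. *)
Lemma gauge_adj i (j : 'I_(n i)) h :
  U (adj (X j) h) = (l i)^* *: adj (X j) (U h).
Proof.
have [_ Us] := Uunitary.
apply: inner_eq => y; have [g _ <-] : range U y by rewrite Us.
rewrite unitary_inner -(adjX cX j g h) -unitary_inner gauge_letter innerZl.
by rewrite (adjX cX j (U g) (U h)) innerZr conjCK.
Qed.

Lemma gauge_Phi i Y : linear Y -> (forall h, U (Y h) = Y (U h)) ->
  forall h, U (Phi X i Y h) = Phi X i Y (U h).
Proof.
move=> lY UY h; rewrite /Phi linear_sum; apply: eq_bigr => j _.
rewrite gauge_letter UY gauge_adj.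
have YZ a x : Y (a *: x) = a *: Y x.
  have Y0 : Y 0 = 0.
    have := lY 1 0 0; rewrite !scale1r !addr0 => /eqP.
    by rewrite -subr_eq subrr => /eqP.
  by rewrite -[a *: x]addr0 lY Y0 addr0.
by rewrite YZ linearZ/= scalerA l1 scale1r.
Qed.

Lemma gauge_defect h : U (defect X h) = defect X (U h).
Proof.
have step i Y : linear Y -> (forall g, U (Y g) = Y (U g)) ->
    forall g, U ((Y - Phi X i Y) g) = (Y - Phi X i Y) (U g).
  move=> lY UY g; change (U (Y g - Phi X i Y g) = Y (U g) - Phi X i Y (U g)).
  by rewrite linearB/= UY gauge_Phi.
suff : linear (defect X) /\ forall h, U (defect X h) = defect X (U h) by case.
rewrite defectE; elim: (index_enum _) => [//|i r [lY UY]].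
by split; [exact: subPhi_linear|exact: step].
Qed.

Variable w : H.
Hypothesis w0 : w != 0.
Hypothesis defect_w : forall h, defect X h = inner h w *: w.

Lemma gauge_defect_vector : exists2 x : R[i], x * x^* = 1 & U w = x *: w.
Proof.
have ww0 : inner w w != 0 by rewrite gt_eqF// inner_gt0.
have [x Uw] : exists x, U w = x *: w.
  exists (inner (U w) w / inner w w).
  apply: (scalerI ww0); rewrite scalerA mulrCA mulfV// mulr1.
  by rewrite -linearZ/= -defect_w gauge_defect defect_w.
exists x => //; apply: (mulIf ww0).
by rewrite mul1r -[RHS]unitary_inner Uw innerZl innerZr mulrA.
Qed.

Lemma gauge_word i (a : seq 'I_(n i)) h :
  U (word_op X a h) = l i ^+ size a *: word_op X a (U h).
Proof.
elim: a => [|j a ih] /=; first by rewrite expr0 scale1r.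
by rewrite gauge_letter ih linearZ/= scalerA exprS.
Qed.

Lemma gauge_words r b h :
  U (word_ops X r b h) = (\prod_(i <- r) l i ^+ size (b i)) *: word_ops X r b (U h).
Proof.
elim: r => [|i r ih] /=; first by rewrite big_nil scale1r.
by rewrite gauge_word ih linearZ/= scalerA big_cons.
Qed.

End Gauge.

Section Graded.
Context {R : realType} {H : hilbertType R} {k : nat} {n : 'I_k -> nat}.
Variable X : op_tuple H n.
Hypothesis cX : forall i (j : 'I_(n i)), continuous (X j).
Hypothesis gX : graded X.
Variable w : H.
Hypothesis w0 : w != 0.
Hypothesis defect_w : forall h, defect X h = inner h w *: w.
Implicit Types (b c : words (n:=n)).

(** The gauge group acts on T_b w through a character of the torus that
    remembers the lengths of the components of b, and unitaries keep
    eigenvectors of distinct eigenvalues orthogonal. *)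
Lemma graded_orthogonal b c i0 : size (b i0) != size (c i0) ->
  inner (Tword X b w) (Tword X c w) = 0.
Proof.
wlog bc : b c / (size (b i0) < size (c i0))%N.
  move=> W; rewrite neq_ltn => /orP[bc|cb]; first by apply: W; rewrite ?ltn_eqF.
  by rewrite innerC W ?conjC0// ltn_eqF.
(* A gauge parameter z with z ^ m = -1 in the coordinate i0 separates the two
   lengths, which differ by m. *)
move=> _; pose m := (size (c i0) - size (b i0))%N.
have m0 : (0 < m)%N by rewrite subn_gt0.
pose z : R[i] := m.-root (-1).
have zm : z ^+ m = -1 by rewrite rootCK.
have z1 : `|z| = 1.
  by apply/eqP; rewrite -(pexpr_eq1 m0)// -normrX zm normrN1.
have zz : z * z^* = 1 by rewrite -normCK z1 expr1n.
have [U [Uu _ _ _ Ug]] := gX.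
pose l : 'rV[R[i]^o]_k := \row_i (if i == i0 then z else 1).
have lE i : l 0 i = if i == i0 then z else 1 by rewrite mxE.
have tl : torus l by move=> i; rewrite lE; case: ifP; rewrite ?normr1.
have l1 i : (l 0 i : R[i]) * (l 0 i : R[i])^* = 1.
  by rewrite lE; case: ifP => // _; rewrite conjC1 mulr1.
have Ul := Uu _ tl; have Ugl := Ug _ tl.
have [x xx Uw] := gauge_defect_vector cX Ul Ugl l1 w0 defect_w.
have UT d : U l (Tword X d w) = (z ^+ size (d i0) * x) *: Tword X d w.
  rewrite /Tword (gauge_words Ul Ugl) Uw linearZ/= scalerA; congr (_ * _ *: _).
  rewrite (bigD1 i0)//= lE eqxx big1 ?mulr1// => i /negbTE ii.
  by rewrite lE ii expr1n.
apply/eqP; apply: contraT => bc0.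
have := unitary_inner Ul (Tword X b w) (Tword X c w).
rewrite !UT innerZl innerZr mulrA -[RHS]mul1r => /(mulIf bc0).
rewrite !rmorphM/= rmorphXn/= mulrACA xx mulr1.
have zcm : z^* ^+ m = -1 by rewrite -rmorphXn zm rmorphN rmorph1.
rewrite -(subnKC (ltnW bc)) -/m exprD zcm mulrA -exprMn zz expr1n mul1r => /eqP.
by rewrite eq_sym -addr_eq0 -[1 + 1]/(2%:R) pnatr_eq0.
Qed.

Hypothesis comX : forall s t (i : 'I_(n s)) (j : 'I_(n t)) h, s != t ->
  X i (X j h) = X j (X i h).
Hypothesis posX : forall p, positive_op (Delta X p idfun).
Hypothesis pureX : pure X.

Lemma pure_small (h : H) (e : R[i]) : 0 < e -> exists M, forall N, (M <= N)%N ->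
  \sum_(i < k) inner (iter N (Phi X i) idfun h) h < e.
Proof.
move=> e0.
have : \sum_(i <- index_enum 'I_k) (inner (iter N (Phi X i) idfun h) h : R[i]^o)
    @[N --> \oo] --> \sum_(i <- index_enum 'I_k) (inner 0 h : R[i]^o).
  by apply: cvg_sum_seq => i _; apply: inner_cvg; exact: pureX.
move=> /cvgrPdist_lt/(_ _ e0)[M _ MN]; exists M => N /MN.
under eq_bigr do rewrite linear0l; rewrite big1// sub0r normrN.
apply: le_lt_trans; apply: real_ler_norm; apply: ger0_real.
apply: sumr_ge0 => i _; apply: (iter_Phi_pos cX) => g; exact: inner_ge0.
Qed.

Definition boxspan (q : 'I_k -> nat) : set H :=
  lin_span [set` [seq Tword X b w | b <- box q]].

Lemma MspaceE q : Mspace X q = boxspan (fun i => (q i).+1).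
Proof.
have w_range : range (defect X) w.
  exists ((inner w w)^-1 *: w) => //.
  by rewrite defect_w innerZl mulVf ?scale1r// gt_eqF// inner_gt0.
apply: lin_span_eq => x /=.
  move=> [b [_ [bq [h _ <-] ->]]]; rewrite compose_allE defect_w.
  rewrite -/(word_ops X _ b _) linearZ/=; apply: lin_spanZ.
  apply: lin_span_sub => /=; apply: map_f.
  rewrite mem_box; apply/forallP => i; rewrite ltnS; exact: bq.
move=> /mapP[b]; rewrite mem_box => /forallP bq ->.
apply: lin_span_sub; exists b, w; split => //.
by rewrite compose_allE.
Qed.

(** On the span of a box the larger boxes contribute nothing more, by
    orthogonality; so the lower frame bound holds with the error terms of
    arbitrarily large boxes, which vanish in the limit by purity. *)
Lemma box_parseval q x : boxspan q x ->
  \sum_(b <- box q) `|inner x (Tword X b w)| ^+ 2 = inner x x.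
Proof.
move=> qx.
have x_orth c : c \notin box q -> inner x (Tword X c w) = 0.
  move=> cq; move: x qx; apply: lin_span_ind => [|a y z /mapP[b bq ->] zc].
    by rewrite linear0l.
  rewrite innerDl innerZl zc addr0.
  have [i ci] : exists i, ~~ (size (c i) < q i)%N.
    by apply/existsP; rewrite -negb_forall -mem_box.
  rewrite (@graded_orthogonal b c i) ?mulr0//.
  move: bq; rewrite mem_box => /forallP/(_ i).
  by apply: contraTneq => ->.
apply/eqP; rewrite eq_le (frame_upper cX comX posX defect_w)/=.
have sr : inner x x - \sum_(b <- box q) `|inner x (Tword X b w)| ^+ 2 \is Num.real.
  by rewrite rpredB ?ger0_real ?inner_ge0// sumr_ge0// => b _; rewrite exprn_ge0.
rewrite -subr_le0 real_leNgt ?real0//; apply/negP => e0.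
have [M MN] := pure_small x e0.
pose N := maxn M (\max_i q i).
have qN i : (q i <= N)%N by rewrite leq_max (leq_bigmax i) orbT.
suff A : inner x x - \sum_(b <- box q) `|inner x (Tword X b w)| ^+ 2 <=
    \sum_(i < k) inner (iter N (Phi X i) idfun x) x.
  by have := le_lt_trans A (MN N (leq_maxl _ _)); rewrite ltxx.
rewrite lerBlDr -lerBlDl.
have := frame_lower cX comX posX defect_w (fun=> N) x => /le_trans; apply.
rewrite (bigID (mem (box q)))/= [X in _ + X]big1 ?addr0; last first.
  by move=> b /x_orth ->; rewrite normr0 expr0n.
rewrite -big_filter le_eqVlt; apply/orP; left; apply/eqP.
apply: perm_big; apply: uniq_perm; rewrite ?filter_uniq ?uniq_box//.
move=> b; rewrite mem_filter; case: (boolP (b \in box q)) => //=.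
rewrite !mem_box => /forallP bq; apply/forallP => i.
exact: leq_trans (bq i) (qN i).
Qed.

Lemma dim_Mspace q : (Defs.dim (Mspace X q))%:R =
  \sum_(b <- box (fun i => (q i).+1)) inner (Tword X b w) (Tword X b w).
Proof. by rewrite MspaceE; apply: dim_frame => x; exact: box_parseval. Qed.

(** The projection of h on the span of a box has the same inner products with
    the frame vectors of that box as h, so it misses at most the error term of
    the lower frame bound. *)
Lemma graded_onb : exists E, orthonormal_basis inner [set: H] E.
Proof.
apply: (exists_onb (L := fun N => [seq Tword X b w | b <- box (fun=> N)])).
move=> h e e0; have [N /(_ N (leqnn _)) hN] := pure_small h e0.
pose L := [seq Tword X b w | b <- box (fun=> N)]; have og := gram_schmidt_orthonormal L.
have pL := proj_span (gram_schmidt L) h; rewrite gram_schmidt_span in pL.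
exists N, (proj inner (gram_schmidt L) h); split => //.
rewrite (bessel_eq (@inner_inner_on R H))// -(dot_self_proj (@inner_inner_on R H))//.
rewrite -(box_parseval pL).
rewrite (eq_big_seq (fun b => `|inner h (Tword X b w)| ^+ 2)); last first.
  move=> b bN; congr (`|_| ^+ 2); apply/eqP; rewrite eq_sym -subr_eq0 -innerBl.
  have Tb : lin_span [set` gram_schmidt L] (Tword X b w).
    by rewrite gram_schmidt_span; apply: lin_span_sub; exact: map_f.
  by rewrite -(proj_id og Tb) (dot_residue_proj (@inner_inner_on R H)).
rewrite ltrBlDr -ltrBlDl; apply: lt_le_trans (frame_lower cX comX posX defect_w (fun=> N) h).
by rewrite ltrD2l ltrN2.
Qed.

End Graded.

(** * Averages of decreasing functions of several integers *)

Section Averages.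
Context {R : realType} {k : nat}.
Implicit Types (q : 'I_k -> nat) (s : seq ('I_k -> nat)).

Definition incr_coord q i : 'I_k -> nat := fun j => (q j + (j == i))%N.

Lemma antitone_of_steps (a : ('I_k -> nat) -> R[i]) :
  (forall q i, a (incr_coord q i) <= a q) ->
  forall q q', (forall i, (q i <= q' i)%N) -> a q' <= a q.
Proof.
move=> aS q q' qq'; move: {2}(\sum_i (q' i - q i))%N (erefl (\sum_i (q' i - q i))%N) => d.
elim: d q qq' => [|d ih] q qq' E.
  suff -> : q = q' by [].
  apply/funext => i; apply/eqP; rewrite eqn_leq qq'/= -subn_eq0.
  by move/eqP: E; rewrite sum_nat_eq0 => /forallP/(_ i).
have [i qi] : exists i, (q i < q' i)%N.
  apply/existsP; apply: contraPT E; rewrite negb_exists => /forallP qq.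
  rewrite big1// => i _; apply/eqP; rewrite subn_eq0 leqNgt; exact: qq.
apply: le_trans (aS q i); apply: ih => [j|].
  by rewrite /incr_coord; case: eqVneq => [->|_]; rewrite ?addn1// addn0.
apply/eqP; rewrite -eqSS -E (bigD1 i)//= [X in _ == X](bigD1 i)//=.
rewrite /incr_coord eqxx addn1 -addSn subnSK//; apply/eqP; congr (_ + _)%N.
by apply: eq_bigr => j /negbTE ->; rewrite addn0.
Qed.

(** If the index vectors with some small coordinate become negligible, then
    averages of a decreasing function of them tend to its infimum. *)
Lemma average_cvg (a : ('I_k -> nat) -> R[i]) (l : R[i]) (s : nat -> seq ('I_k -> nat)) :
  (forall q i, a (incr_coord q i) <= a q) -> (forall q, l <= a q) ->
  (forall e : R[i], 0 < e -> exists q, a q < l + e) ->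
  (forall m, s m <> [::]) ->
  (forall M i, exists B, forall K, exists m0, forall m, (m0 <= m)%N ->
     (count (fun q => q i < M) (s m) * K <= B * size (s m))%N) ->
  ((\sum_(q <- s m) a q) / (size (s m))%:R : R[i]^o) @[m --> \oo] --> (l : R[i]^o).
Proof.
move=> aS la al s0 sM; have anti := antitone_of_steps aS.
pose C := a (fun=> 0%N) - l.
have C0 : 0 <= C by rewrite subr_ge0.
have aC q : a q - l <= C by rewrite lerB//; exact: anti.
apply/cvgrPdist_le => e e0.
have e2 : 0 < e / 2 by rewrite divr_gt0.
have [q0 aq0] := al _ e2.
pose M := \max_i q0 i.
have /choice[B BP] := sM M.
have CB : 0 <= C * (\sum_i B i)%:R by rewrite mulr_ge0.
have CB1 : 0 < C * (\sum_i B i)%:R + 1 by rewrite ltr_wpDl.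
have [K0 K0e] := complex_lt_invSn (divr_gt0 e2 CB1).
pose K := K0.+1.
have /choice[m0 m0P] := fun i => BP i K.
exists (\max_i m0 i) => // m /= mm.
have ss : 0 < (size (s m))%:R :> R[i].
  by rewrite ltr0n lt0n size_eq0; apply/eqP; exact: s0.
(* The sum on the right is zero when all coordinates are at least M, where a q
   is close to l, and at least one for the other vectors. *)
have pt q : a q - l <= e / 2 + C * (\sum_i (q i < M)%N)%:R.
  have [/forallP qM|] := boolP [forall i, (M <= q i)%N].
    apply: (@le_trans _ _ (e / 2)); last by rewrite lerDl mulr_ge0.
    rewrite lerBlDl ltW//; apply: le_lt_trans aq0; apply: anti => i.
    by apply: leq_trans (qM i); exact: leq_bigmax.
  rewrite negb_forall => /existsP[i qi].
  apply: (le_trans (aC q)); apply: (@le_trans _ _ (C * 1)); first by rewrite mulr1.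
  apply: ler_wpDl; first exact: ltW.
  by rewrite ler_wpM2l// ler1n (bigD1 i)//= [(q i < M)%N]ltnNge qi.
have sumC (c : R[i]) : \sum_(q <- s m) c = c * (size (s m))%:R.
  by rewrite big_const_seq count_predT iter_addr addr0 mulr_natr.
have sumE : (\sum_(q <- s m) a q) / (size (s m))%:R - l =
    (\sum_(q <- s m) (a q - l)) / (size (s m))%:R.
  rewrite sumrB mulrBl; congr (_ - _).
  by rewrite sumC mulfK// gt_eqF.
rewrite distrC sumE ger0_norm; last first.
  by rewrite divr_ge0// sumr_ge0// => q _; rewrite subr_ge0.
rewrite ler_pdivrMr//.
apply: (@le_trans _ _ (\sum_(q <- s m) (e / 2 + C * (\sum_i (q i < M)%N)%:R))).
  exact: ler_sum.
rewrite big_split/= sumC.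
rewrite -mulr_sumr -natr_sum exchange_big/=.
have countE i : (\sum_(q <- s m) (q i < M))%N = count (fun q => q i < M)%N (s m).
  by rewrite -sum1_count [RHS]big_mkcond/=; apply: eq_bigr => q _; case: (_ < _)%N.
under eq_bigr do rewrite countE.
set c := (\sum_i count _ _)%N.
have cK : (c * K <= (\sum_i B i) * size (s m))%N.
  rewrite /c !big_distrl/=; apply: leq_sum => i _; apply: m0P.
  by apply: leq_trans mm; exact: leq_bigmax.
have K_gt0 : 0 < K%:R :> R[i] by rewrite ltr0n.
have c_le : c%:R <= (\sum_i B i)%:R * (size (s m))%:R * K%:R^-1 :> R[i].
  by rewrite ler_pdivlMr// -!natrM ler_nat.
rewrite [leRHS](_ : _ = e / 2 * (size (s m))%:R + e / 2 * (size (s m))%:R); last by field.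
rewrite lerD2l.
apply: le_trans (ler_wpM2l C0 c_le) _.
rewrite !mulrA mulrAC ler_pM2r//.
rewrite ltr_pdivlMr// in K0e.
apply: le_trans (ltW K0e); rewrite mulrC ler_pM2l ?invr_gt0//.
by rewrite lerDl.
Qed.

Lemma card_simplex m :
  #|[pred q : {ffun 'I_k -> 'I_m.+1} | (\sum_i q i <= m)%N]| = 'C(m + k, k).
Proof.
rewrite addnC -(card_partial_ord_partitions k m) -[LHS]cardsE.
pose f (q : {ffun 'I_k -> 'I_m.+1}) : k.-tuple 'I_m.+1 := [tuple q i | i < k].
have fi : injective f.
  move=> q q' E; apply/ffunP => i.
  by have := congr1 (fun t => tnth t i) E; rewrite !tnth_mktuple.
rewrite -(card_imset _ fi); apply: eq_card => t.
rewrite [in RHS]inE big_tuple; apply/imsetP/idP => [[q + ->]|tm].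
  by rewrite !inE; under [X in _ -> (X <= _)%N]eq_bigr do rewrite tnth_mktuple.
exists [ffun i => tnth t i].
  by rewrite !inE; under eq_bigr do rewrite ffunE.
by apply: eq_from_tnth => i; rewrite tnth_mktuple ffunE.
Qed.

Definition simplex (m : nat) : seq ('I_k -> nat) :=
  [seq (fun i => nat_of_ord (f i)) |
    f : {ffun 'I_k -> 'I_m.+1} <- enum [pred q : {ffun 'I_k -> 'I_m.+1} | (\sum_i q i <= m)%N]].

Lemma size_simplex m : size (simplex m) = 'C(m + k, k).
Proof. by rewrite size_map -cardE card_simplex. Qed.

Lemma expn_le_ffact m p : (m.+1 ^ p <= (m + p) ^_ p)%N.
Proof.
elim: p => // p ih; rewrite expnS addnS ffactnS /= leq_mul//.
by rewrite ltnS leq_addr.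
Qed.

(** A coordinate fixed below M leaves M (m+1)^(k-1) vectors, against at least
    (m+1)^k / k! vectors in the whole simplex. *)
Lemma count_simplex m M i :
  (count (fun q => q i < M) (simplex m) * m.+1 <= M * k`! * size (simplex m))%N.
Proof.
rewrite size_simplex count_map.
have c1 : (count (preim (fun (q : {ffun 'I_k -> 'I_m.+1}) (i : 'I_k) => nat_of_ord (q i))
      (fun q => q i < M)) (enum [pred q : {ffun 'I_k -> 'I_m.+1} | \sum_i q i <= m])
    <= \sum_(q : {ffun 'I_k -> 'I_m.+1}) (q i < M))%N.
  rewrite -sum1_count big_enum_cond/= big_mkcond/=.
  by apply: leq_sum => q _; case: ifP => // /andP[_ ->].
(* The indicator of q i < M is a product of functions of the coordinates, so
   the count factors. *)
pose g (j : 'I_k) (x : 'I_m.+1) : nat := if j == i then nat_of_bool (x < M)%N else 1%N.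
have c2 : (\sum_(q : {ffun 'I_k -> 'I_m.+1}) (q i < M) =
    \sum_(q : {ffun 'I_k -> 'I_m.+1}) \prod_j g j (q j))%N.
  apply: eq_bigr => q _; rewrite (bigD1 i)//= /g eqxx big1 ?muln1// => j.
  by move=> /negbTE ->.
rewrite c2 -bigA_distr_bigA (bigD1 i)//= in c1.
have gi : (\sum_x g i x <= M)%N.
  rewrite /g eqxx -(big_mkord xpredT (fun x => nat_of_bool (x < M)%N)).
  elim: (m.+1) => [|p ih]; first by rewrite big_geq.
  have [Mp|pM] := leqP M p.
    by rewrite big_nat_recr//= ltnNge Mp addn0.
  apply: (@leq_trans (\sum_(0 <= i0 < p.+1) 1)%N);
    first by apply: leq_sum => x _; case: (_ < _)%N.
  by rewrite sum_nat_const_nat muln1 subn0.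
apply: (@leq_trans (M * m.+1 ^ k)).
  apply: leq_trans (leq_mul c1 (leqnn _)) _; rewrite -mulnA; apply: leq_mul => //.
  rewrite (eq_bigr (fun=> m.+1)); last first.
    move=> j /negbTE ji; rewrite /g ji sum_nat_const card_ord muln1//.
  have <- : (\prod_(j < k) m.+1 = m.+1 ^ k)%N by rewrite prod_nat_const card_ord.
  by rewrite [leqRHS](bigD1 i)//= mulnC.
by rewrite -mulnA leq_mul2l mulnC bin_ffact expn_le_ffact orbT.
Qed.

End Averages.

(** * Curvature and Euler characteristic as averages of one density *)

Section BoxCounting.
Context {k : nat} {n : 'I_k -> nat}.
Hypothesis n1 : forall i, (0 < n i)%N.
Implicit Types (b : words (n:=n)) (q : 'I_k -> nat).

Definition degree b : 'I_k -> nat := fun i => size (b i).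

(** The words whose i-th component is shorter than M form a smaller box; only
    the factor of the i-th coordinate changes, and it stays bounded while that
    of the whole box is at least its side. *)
Lemma count_box q i M :
  (count (fun b => degree b i < M) (box q) * q i <=
   (\sum_(0 <= p < M) n i ^ p) * size (box (n:=n) q))%N.
Proof.
pose q' j := if j == i then minn M (q i) else q j.
have -> : count (fun b => degree b i < M)%N (box q) = size (box (n:=n) q').
  rewrite -size_filter; apply: perm_size; apply: uniq_perm.
  - by rewrite filter_uniq// uniq_box.
  - exact: uniq_box.
  move=> b; rewrite mem_filter !mem_box /degree.
  apply/andP/forallP => [[bM /forallP bq] j|bq].
    by rewrite /q'; case: eqVneq => [->|_]; rewrite ?leq_min ?bM bq.
  have := bq i; rewrite /q' eqxx leq_min => /andP[bM bqi]; split => //.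
  by apply/forallP => j; have := bq j; rewrite /q'; case: eqVneq => [->|].
rewrite !size_box (bigD1 i)//= [X in (_ <= _ * X)%N](bigD1 i)//=.
have -> : (\prod_(j < k | j != i) \sum_(0 <= p < q' j) n j ^ p =
    \prod_(j < k | j != i) \sum_(0 <= p < q j) n j ^ p)%N.
  by apply: eq_bigr => j /negbTE ji; rewrite /q' ji.
rewrite mulnA mulnAC; apply: leq_mul => //; rewrite /q' eqxx.
apply: leq_mul.
  rewrite [leqRHS](@big_cat_nat _ _ _ (minn M (q i)))//= ?geq_minl//.
  exact: leq_addr.
rewrite -[X in (X <= _)%N]subn0 -[X in (X <= _)%N]muln1 -sum_nat_const_nat.
by apply: leq_sum => p _; rewrite expn_gt0 n1.
Qed.

End BoxCounting.

Section Curvature.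
Context {R : realType} {H : hilbertType R} {k : nat} {n : 'I_k -> nat}.
Variable X : op_tuple H n.
Hypothesis n1 : forall i, (0 < n i)%N.
Hypothesis polyX : polyball X.
Hypothesis gX : graded X.
Hypothesis pureX : pure X.
Variable w : H.
Hypothesis w0 : w != 0.
Hypothesis defect_w : forall h, defect X h = inner h w *: w.
Implicit Types (q : 'I_k -> nat) (b : words (n:=n)).

Let cX : forall i (j : 'I_(n i)), continuous (X j). Proof. by case: polyX. Qed.
Let comX : forall s t (i : 'I_(n s)) (j : 'I_(n t)) h, s != t ->
  X i (X j h) = X j (X i h). Proof. by case: polyX. Qed.
Let posX : forall p, positive_op (Delta X p idfun). Proof. by case: polyX. Qed.

Definition density q : R[i] := degree_mass X w q / (size (words_of_degree (n:=n) q))%:R.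

Let words_of_degree_gt0 q : (0 < size (words_of_degree (n:=n) q))%N.
Proof. by rewrite size_words_of_degree prodn_gt0// => i; rewrite expn_gt0 n1. Qed.

Lemma density_ge0 q : 0 <= density q.
Proof. by rewrite divr_ge0 ?degree_mass_ge0. Qed.

Lemma density_step q i : density (incr_coord q i) <= density q.
Proof.
have E : size (words_of_degree (n:=n) (incr_coord q i)) =
    (n i * size (words_of_degree (n:=n) q))%N.
  rewrite !size_words_of_degree (bigD1 i)//= [in RHS](bigD1 i)//= /incr_coord eqxx addn1 expnS.
  rewrite -mulnA; congr (_ * (_ * _))%N.
  by apply: eq_bigr => j /negbTE ->; rewrite addn0.
rewrite /density E natrM invfM mulrA ler_pM2r ?invr_gt0 ?ltr0n//.
by rewrite ler_pdivrMr ?ltr0n// mulrC; exact: degree_mass_le.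
Qed.

(** Over the words of one degree the density is constant and is the average of
    the |T_b w|^2, so both sums agree degree by degree. *)
Lemma sum_box q :
  \sum_(b <- box q) inner (Tword X b w) (Tword X b w) =
  \sum_(b <- box q) density (degree (n:=n) b).
Proof.
pose N := \max_i q i.
pose deg b : {ffun 'I_k -> 'I_N.+1} := [ffun i => inord (size (b i))].
have degE b i : b \in box q -> nat_of_ord (deg b i) = size (b i).
  rewrite mem_box => /forallP/(_ i) bq; rewrite ffunE inordK// ltnS.
  by apply: leq_trans (ltnW bq) _; exact: leq_bigmax.
have group (F : words (n:=n) -> R[i]) : \sum_(b <- box q) F b =
    \sum_(p : {ffun 'I_k -> 'I_N.+1} | [forall i, (p i < q i)%N])
      \sum_(b <- words_of_degree (fun i => p i)) F b.
  rewrite big_seq (partition_big deg (fun p => [forall i, (p i < q i)%N])).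
    apply: eq_bigr => p /forallP pq; rewrite -big_filter; apply: perm_big.
    apply: uniq_perm; rewrite ?filter_uniq ?uniq_box ?uniq_words_of_degree// => b.
    rewrite mem_filter mem_words_of_degree; apply/andP/forallP => [[/andP[bq /eqP <-] _] i|bp].
      by rewrite degE.
    have bq : b \in box q.
      by rewrite mem_box; apply/forallP => i; rewrite (eqP (bp i)).
    rewrite bq; split => //=; apply/eqP/ffunP => i; apply: val_inj.
    by rewrite /= degE// (eqP (bp i)).
  move=> b bq; apply/forallP => i; rewrite degE//.
  by move: bq; rewrite mem_box => /forallP.
rewrite !group; apply: eq_bigr => p _; rewrite -/(degree_mass X w _).
rewrite (eq_big_seq (fun=> density (fun i => p i))); last first.
  move=> b; rewrite mem_words_of_degree => /forallP bp; congr density; apply/funext => i.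
  apply/eqP; exact: bp.
rewrite big_const_seq count_predT iter_addr addr0 -mulr_natr.
by rewrite /density divfK// pnatr_eq0 -lt0n.
Qed.

Lemma euler_ratioE q : euler_ratio X q =
  (\sum_(b <- box (fun i => (q i).+1)) density (degree (n:=n) b)) /
  (size (box (n:=n) (fun i => (q i).+1)))%:R.
Proof.
rewrite /euler_ratio (dim_Mspace cX gX w0 defect_w comX posX pureX) sum_box.
congr (_ / _); rewrite size_box natr_prod; apply: eq_bigr => i _.
by rewrite natr_sum; apply: eq_bigr => p _; rewrite natrX.
Qed.

Lemma curv_meanE m : curv_mean X m =
  (\sum_(q <- simplex m) density q) / (size (simplex (k:=k) m))%:R.
Proof.
rewrite /curv_mean size_simplex mulrC; congr (_ / _).
rewrite big_map big_enum_cond/=; apply: eq_big => [q|q _].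
  by rewrite inE andbT.
rewrite (berezin_traceE cX comX w0 defect_w).
  by rewrite (fock_trace_card _ (uniq_words_of_degree _) (@mem_words_of_degree _ _ _)).
exact: (graded_onb cX gX w0 defect_w comX posX pureX).
Qed.

Lemma curvature_euler_limit : exists l : R[i],
  curv_mean X @ \oo --> (l : R[i]^o) /\
  forall q : nat -> 'I_k -> nat, increasing_cofinal q ->
    euler_ratio X (q m) @[m --> \oo] --> (l : R[i]^o).
Proof.
have [l [ld dl]] := exists_approx_inf (F := density) (fun=> 0%N)
  (fun q => ger0_real (density_ge0 q)) density_ge0.
exists l; split.
  rewrite (funext curv_meanE).
  apply: (average_cvg density_step ld dl) => [m E|M i].
    by have := size_simplex (k:=k) m; rewrite E/= => /esym/eqP;
      rewrite eqn0Ngt bin_gt0 leq_addl.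
  exists (M * k`!)%N => K; exists K => m Km.
  apply: leq_trans (count_simplex m M i).
  by rewrite leq_mul2l (leqW Km) orbT.
move=> q [qinc qcof].
pose Q m i := (q m i).+1.
have -> : (fun m => euler_ratio X (q m)) = (fun m =>
    (\sum_(p <- [seq degree (n:=n) b | b <- box (n:=n) (Q m)]) density p) /
    (size [seq degree (n:=n) b | b <- box (n:=n) (Q m)])%:R).
  by apply/funext => m; rewrite euler_ratioE big_map size_map.
apply: (average_cvg density_step ld dl) => [m /(congr1 size)/eqP|M i].
  rewrite size_map /= size_box eqn0Ngt prodn_gt0// => j.
  by rewrite big_nat_recl// expn0 addSn.
exists (\sum_(0 <= p < M) n i ^ p)%N => K.
have [m0 m0K] := qcof (fun=> K); exists m0 => m mm.
rewrite count_map size_map; apply: leq_trans (count_box n1 (Q m) i M).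
rewrite leq_mul2l; apply/orP; right; apply: leqW; apply: leq_trans (m0K i) _.
by rewrite -(subnKC mm); elim: (m - m0)%N => [|d ih]; rewrite ?addn0// addnS (leq_trans ih).
Qed.

End Curvature.

Unset Implicit Arguments.
Set Printing Implicit Defensive.

Theorem theorem3p3 (R : realType) (H : hilbertType R) (k : nat)
    (n : 'I_k -> nat) (T : op_tuple H n) (hk : (0 < k)%N)
    (hn : forall i, (2 <= n i)%N) (hT : polyball T)
    (hgraded : graded T) (hpure : pure T) (hrank : has_rank T 1) :
  [/\ cvg (curv_mean T @ \oo), exists c, is_euler_char T c &
      curv T = euler_char T].
Proof.
have [cT comT posT] := hT.
have [w w0 wE] := rank_one_form (defect_linear cT) (posT _) hrank.
have [l [cl el]] := curvature_euler_limit (fun i => ltnW (hn i)) hT hgraded hpure w0 wE.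
have ex : increasing_cofinal (fun m (_ : 'I_k) => m).
  split => // r; exists (\max_i r i) => i; exact: leq_bigmax.
split.
- by apply/cvg_ex; exists l.
- by exists l.
rewrite /curv (cvg_lim _ cl); last exact: norm_hausdorff.
rewrite /euler_char; case: xgetP => [c _ /(_ _ ex) ec|/(_ l) no]; last by case: no.
by apply: (cvg_unique _ (el _ ex) ec); exact: norm_hausdorff.
Qed.
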